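(* Let $\lambda\in\mathbb{R}$ be fixed. The development of the touching curve $\mathcal{C}_\lambda$ onto $E$ is the curve $$\mathcal{C}_\lambda^*=\{(\kappa_1^*(\lambda,t),\kappa_2^*(\lambda,t)): t\in\mathbb{R}\}$$ (values of $t$ with $1+\lambda\cos h(t)=0$ being excluded) with parametrization $$\kappa_1^*(\lambda,t)=\operatorname{sgn}(t)\left\lfloor\frac{3|t|}{4\pi}+\frac12\right\rfloor\frac{4\pi}{3\sqrt3}+\operatorname{sgn}(h(t))\,\tilde\kappa_1(\lambda,h(t)),\qquad \kappa_2^*(\lambda,t)=\tilde\kappa_2(\lambda,h(t)),$$ where, with $c=\cos t$, $s=\sin t$, $$\tilde\kappa_1(\lambda,t)=\frac{2\sqrt3}9\left(\arccos\frac{\sqrt2\,c}{\sqrt{1+c}}+\frac{(1-2\lambda)|s|\sqrt{2(1+2c)}}{(1+\lambda c)\sqrt{1+c}}\right),$$ $$\tilde\kappa_2(\lambda,t)=\frac{\sqrt3}9\left(\ln\frac2{1+c}+\frac{4+7\lambda+(11\lambda-4)c}{1+\lambda c}\right),$$ $$h(t)=t-\operatorname{sgn}(t)\left\lfloor\frac{3|t|}{4\pi}+\frac12\right\rfloor\frac{4\pi}3.$$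
   Context: $\lfloor\cdot\rfloor$ denotes the integer part. The extended oloid $\mathcal{O}$ is the developable surface containing the surface of the convex hull of the circles $k_A: x^2+(y+\frac12)^2=1, z=0$ and $k_B:(y-\frac12)^2+z^2=1, x=0$; it is the union of the generating lines $x=\omega_1(m,t)$, $y=\omega_2(m,t)$, $z=\pm\omega_3(m,t)$, $m\in\mathbb{R}$, for $t\in[-\frac{2\pi}3,\frac{2\pi}3]$, where $$\omega_1=(1-m)\sin t,\quad \omega_2=(1-m)\left(-\tfrac12-\cos t\right)+m\left(\tfrac12-\tfrac{\cos t}{1+\cos t}\right),\quad \omega_3=\frac{m\sqrt{1+2\cos t}}{1+\cos t}.$$ Its inscribed quadrics are $\mathcal{Q}_\lambda:\ \frac{x^2}{1-\lambda}+\frac{(y-\lambda+1/2)^2}{1-\lambda+\lambda^2}+\frac{z^2}{\lambda}=1$ (with $\mathcal{Q}_0=k_A$, $\mathcal{Q}_1=k_B$). The touching curve $\mathcal{C}_\lambda$, along which $\mathcal{O}$ and $\mathcal{Q}_\lambda$ touch, consists of the points $(\kappa_1,\kappa_2,\pm\kappa_3)(\lambda,t)$, $t\in[-\frac{2\pi}3,\frac{2\pi}3]$ (poles excluded), lying on the generating lines $(\omega_1,\omega_2,\pm\omega_3)(\cdot,t)$, where $$\kappa_1(\lambda,t)=\frac{(1-\lambda)\sin t}{1+\lambda\cos t},\quad \kappa_2(\lambda,t)=\frac{2\lambda-1+(\lambda-2)\cos t}{2(1+\lambda\cos t)},\quad \kappa_3(\lambda,t)=\frac{\lambda\sqrt{1+2\cos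 t}}{1+\lambda\cos t}.$$ Development: let $E$ be the plane tangent to $\mathcal{O}$ along the generating line $\mathcal{L}_0=\{(\omega_1(m,0),\omega_2(m,0),-\omega_3(m,0)): m\in\mathbb{R}\}$, with a Cartesian $\xi,\eta$-coordinate system in which $\mathcal{L}_0$ is the $\eta$-axis (oriented in the direction of increasing $m$) and the line perpendicular to $\mathcal{L}_0$ through the point $m=0$ is the $\xi$-axis (oriented so that the generating lines for small $t>0$ are developed to $\xi>0$ near the origin). The surface $\mathcal{O}$ is developed (unrolled isometrically, each generating line being mapped isometrically onto a line of $E$) onto $E$, starting from $\mathcal{L}_0$, which is kept fixed, and continuing indefinitely in both directions. The parameter $t\in\mathbb{R}$ labels the successive generating lines in this process: for $t\in[-\frac{2\pi}3,\frac{2\pi}3]$ it is the line $\{(\omega_1,\omega_2,-\omega_3)(m,t):m\in\mathbb{R}\}$, for $t\in[\frac{2\pi}3,2\pi]$ it is the line $\{(\omega_1,\omega_2,\omega_3)(m,\frac{4\pi}3-t):m\in\mathbb{R}\}$, and this is continued periodically with period $\frac{8\pi}3$. ($t$ is the arc length along the double circular arc $\mathcal{C}_0\subset k_A$.) The development of a curve on $\mathcal{O}$ is its image under this process. *)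

(* Defs.v *)
From Stdlib Require Import Reals ZArith.
From Coquelicot Require Import Coquelicot.
Open Scope R_scope.

(** Points of the plane E, in the coordinates (xi, eta), and of space. *)
Definition vec2 : Type := (R * R)%type.
Definition vec3 : Type := (R * R * R)%type.

Definition xi (v : vec2) : R := fst v.
Definition eta (v : vec2) : R := snd v.
Definition px (v : vec3) : R := fst (fst v).
Definition py (v : vec3) : R := snd (fst v).
Definition pz (v : vec3) : R := snd v.

Definition dot2 (v w : vec2) : R := xi v * xi w + eta v * eta w.
Definition dot3 (v w : vec3) : R := px v * px w + py v * py w + pz v * pz w.
Definition det2 (v w : vec2) : R := xi v * eta w - eta v * xi w.

Definition distance2 (v w : vec2) : R :=
  sqrt ((xi v - xi w) ^ 2 + (eta v - eta w) ^ 2).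
Definition distance3 (v w : vec3) : R :=
  sqrt ((px v - px w) ^ 2 + (py v - py w) ^ 2 + (pz v - pz w) ^ 2).

(** Partial derivatives of maps of the two parameters [(m, t)]. *)
Definition d_m2 (F : R -> R -> vec2) (m t : R) : vec2 :=
  (Derive (fun u => xi (F u t)) m, Derive (fun u => eta (F u t)) m).
Definition d_t2 (F : R -> R -> vec2) (m t : R) : vec2 :=
  (Derive (fun u => xi (F m u)) t, Derive (fun u => eta (F m u)) t).
Definition d_m3 (P : R -> R -> vec3) (m t : R) : vec3 :=
  (Derive (fun u => px (P u t)) m, Derive (fun u => py (P u t)) m,
   Derive (fun u => pz (P u t)) m).
Definition d_t3 (P : R -> R -> vec3) (m t : R) : vec3 :=
  (Derive (fun u => px (P m u)) t, Derive (fun u => py (P m u)) t,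
   Derive (fun u => pz (P m u)) t).

(** ** The extended oloid and its touching curves *)

Definition omega1 (m t : R) : R := (1 - m) * sin t.
Definition omega2 (m t : R) : R :=
  (1 - m) * (- (1 / 2) - cos t) + m * (1 / 2 - cos t / (1 + cos t)).
Definition omega3 (m t : R) : R := m * sqrt (1 + 2 * cos t) / (1 + cos t).

Definition kappa1 (lambda t : R) : R :=
  (1 - lambda) * sin t / (1 + lambda * cos t).
Definition kappa2 (lambda t : R) : R :=
  (2 * lambda - 1 + (lambda - 2) * cos t) / (2 * (1 + lambda * cos t)).
Definition kappa3 (lambda t : R) : R :=
  lambda * sqrt (1 + 2 * cos t) / (1 + lambda * cos t).

(** The representative of the label [t] in [[-2 PI / 3, 2 PI)], modulo the
    period [8 PI / 3]; [Int_part] is the floor function. *)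
Definition reduced_label (t : R) : R :=
  t - IZR (Int_part ((t + 2 * PI / 3) / (8 * PI / 3))) * (8 * PI / 3).

(** The line labelled [t] is the line (omega1, omega2, sheet * omega3) taken at
    [base_parameter t], which lies in [[-2 PI / 3, 2 PI / 3]]. *)
Definition base_parameter (t : R) : R :=
  if Rle_dec (reduced_label t) (2 * PI / 3)
  then reduced_label t else 4 * PI / 3 - reduced_label t.
Definition sheet (t : R) : R :=
  if Rle_dec (reduced_label t) (2 * PI / 3) then -1 else 1.

Definition oloid (m t : R) : vec3 :=
  let u := base_parameter t in
  (omega1 m u, omega2 m u, sheet t * omega3 m u).

(** The point of the touching curve on the line labelled [t]; it is meaningful
    when [t] is not a pole. *)
Definition touching_point (lambda t : R) : vec3 :=
  let u := base_parameter t in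
  (kappa1 lambda u, kappa2 lambda u, sheet t * kappa3 lambda u).
Definition touching_pole (lambda t : R) : Prop :=
  1 + lambda * cos (base_parameter t) = 0.

(** ** The development *)

(** At the labels excluded here two sheets meet: [oloid m] is continuous there
    but not differentiable: [1 + 2 cos] vanishes, and the arc of k_A is retraced
    from there on. *)
Definition regular_label (t : R) : Prop :=
  forall k : Z, t <> 2 * PI / 3 + IZR k * (4 * PI / 3).

(** [F m t] is the position in E, after unrolling, of the point [oloid m t] of
    the line labelled [t].  It is a function of [(m, t)] and not of the point of
    space, since the unrolling runs over the surface indefinitely. *)
Record is_development (F : R -> R -> vec2) : Prop := {
  dev_line : forall t m m' : R,
    distance2 (F m t) (F m' t) = distance3 (oloid m t) (oloid m' t);
  dev_continuous : forall m t : R,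
    continuous (fun u => xi (F m u)) t /\ continuous (fun u => eta (F m u)) t;
  dev_differentiable : forall m t : R, regular_label t ->
    ex_derive (fun u => xi (F m u)) t /\ ex_derive (fun u => eta (F m u)) t;
  (* equality of the first fundamental forms *)
  dev_isometry : forall m t : R, regular_label t ->
    dot2 (d_m2 F m t) (d_m2 F m t) = dot3 (d_m3 oloid m t) (d_m3 oloid m t) /\
    dot2 (d_m2 F m t) (d_t2 F m t) = dot3 (d_m3 oloid m t) (d_t3 oloid m t) /\
    dot2 (d_t2 F m t) (d_t2 F m t) = dot3 (d_t3 oloid m t) (d_t3 oloid m t);
  (* Unrolling does not fold the surface over along a generating line.  On the
     strip 0 < m < 1 between the two circles, which the edge of regression does
     not enter, the parameters [(m, t)] induce one orientation of the surface,
     also across the labels that are not regular; its image has one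
     orientation. *)
  dev_unfolded : forall m t m' t' : R,
    0 < m < 1 -> 0 < m' < 1 -> regular_label t -> regular_label t' ->
    0 < det2 (d_m2 F m t) (d_t2 F m t) * det2 (d_m2 F m' t') (d_t2 F m' t');
  (* the line labelled 0 is the eta-axis, with its point m = 0 as origin *)
  dev_start : forall m : R,
    F m 0 = (0, m * distance3 (oloid 0 0) (oloid 1 0));
  dev_xi_orientation : exists delta : R, 0 < delta /\
    forall m t : R, Rabs m < delta -> 0 < t < delta -> 0 < xi (F m t)
}.

(** [q] is the developed position of the point of the touching curve that lies
    on the line labelled [t]. *)
Definition developed_touching_point (F : R -> R -> vec2) (lambda t : R)
    (q : vec2) : Prop :=
  exists m : R, oloid m t = touching_point lambda t /\ q = F m t.

Definition developed_touching_curve (F : R -> R -> vec2) (lambda : R)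
    (q : vec2) : Prop :=
  exists t : R,
    ~ touching_pole lambda t /\ developed_touching_point F lambda t q.

(** ** The parametrization of the developed curve *)

Definition shift (t : R) : R :=
  sign t * IZR (Int_part (3 * Rabs t / (4 * PI) + 1 / 2)).

Definition h (t : R) : R := t - shift t * (4 * PI / 3).

Definition kappa1_tilde (lambda t : R) : R :=
  let c := cos t in let s := sin t in
  2 * sqrt 3 / 9 *
  (acos (sqrt 2 * c / sqrt (1 + c)) +
   (1 - 2 * lambda) * Rabs s * sqrt (2 * (1 + 2 * c)) /
   ((1 + lambda * c) * sqrt (1 + c))).

Definition kappa2_tilde (lambda t : R) : R :=
  let c := cos t in
  sqrt 3 / 9 *
  (ln (2 / (1 + c)) +
   (4 + 7 * lambda + (11 * lambda - 4) * c) / (1 + lambda * c)).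

Definition kappa1_star (lambda t : R) : R :=
  shift t * (4 * PI / (3 * sqrt 3)) + sign (h t) * kappa1_tilde lambda (h t).
Definition kappa2_star (lambda t : R) : R := kappa2_tilde lambda (h t).

Definition touching_curve_star (lambda : R) (q : vec2) : Prop :=
  exists t : R,
    1 + lambda * cos (h t) <> 0 /\
    q = (kappa1_star lambda t, kappa2_star lambda t).

(* Main.v *)
From Stdlib Require Import ZArith Reals Lra Lia.
Require Import Defs.
From Coquelicot Require Import Coquelicot.
Open Scope R_scope.

(** The surface is ruled, and the segments between the two circles all have
    length [sqrt 3].  A development is therefore described by a moving point of
    the plane, the image of the point [m = 0] of the ruling [t], and a moving
    vector of length [sqrt 3], the image of the unit of [m] on that ruling.  The
    theorem follows from two facts about developments: an explicit map is one
    ([unrolled_is_development]), and there is no other ([developments_agree]).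

    The explicit map is read off the claimed parametrization.  The point of
    [C_lambda] on a ruling has the parameter
    [m = lambda (1 + cos t) / (1 + lambda cos t)], so [lambda = 0] and
    [lambda = 1] give the points [m = 0] and [m = 1] of every ruling.  For any
    other [lambda], away from the poles, the claimed point is the combination of
    these two that corresponds to [m] ([kappa1_tilde_on_ruling],
    [kappa2_tilde_on_ruling]).  What remains is that the affine extension in [m]
    is a development.  The labels are cut into cells of width [4 PI / 3] at the
    labels that are not regular.  In space consecutive cells are congruent by a
    half-turn about the y-axis, in the plane by a translation along the xi-axis,
    so it suffices to differentiate in one cell.  In terms of the sine and
    cosine of the half-angle everything is algebraic except for one arc cosine
    and one logarithm, whose derivatives are algebraic; the vector of the ruling turns with
    an angular velocity [turning], and the equality of first fundamental forms
    becomes a list of polynomial identities.  At the ends of the cells the arc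
    cosine takes the value [PI], which makes the translated pieces fit together
    continuously.

    For uniqueness, consider two developments.  By the equality of distances
    both are affine in [m].  The square of the determinant of the partial
    derivatives is fixed by the first fundamental form, and its sign is fixed by
    the orientation of the xi-axis at the label 0, from where it is carried to
    all labels because the surface is not folded ([development_det_neg]).  Hence
    in both developments the rulings turn with the same angular velocity, which
    makes their dot product constant; they agree for [t = 0], so they agree
    always ([developments_rulings]).  Then the velocities of the points [m = 0]
    have the same components with respect to the common ruling, so these points
    agree too ([developments_starts]).  Continuity carries both conclusions
    across the labels that are not regular ([constant_of_derive_zero]). *)

(** * Half-angle identities *)

Lemma cos_half_angle (v : R) : cos v = 2 * cos (v / 2) ^ 2 - 1.
Proof.
  replace (cos v) with (cos (2 * (v / 2))) by (f_equal; field).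
  rewrite cos_2a_cos; ring.
Qed.

Lemma sin_half_angle (v : R) : sin v = 2 * sin (v / 2) * cos (v / 2).
Proof.
  replace (sin v) with (sin (2 * (v / 2))) by (f_equal; field).
  apply sin_2a.
Qed.

Lemma sin_sq (x : R) : sin x ^ 2 = 1 - cos x ^ 2.
Proof. pose proof (sin2_cos2 x) as H; unfold Rsqr in H; lra. Qed.

(** On the arc of labels between two singular ones, the half-angle stays within
    [PI / 3] of zero; this keeps all the denominators below away from zero. *)
Lemma cos_half_ge (v : R) : Rabs v <= 2 * PI / 3 -> 1 / 2 <= cos (v / 2).
Proof.
  intros Hv; apply Rabs_le_between in Hv; pose proof PI_RGT_0.
  destruct (Rle_dec 0 v) as [H0 | H0].
  - rewrite <- cos_PI3; apply cos_decr_1; lra.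
  - rewrite <- cos_neg, <- cos_PI3; apply cos_decr_1; lra.
Qed.

Lemma cos_half_gt (v : R) : Rabs v < 2 * PI / 3 -> 1 / 2 < cos (v / 2).
Proof.
  intros Hv; apply Rabs_lt_between in Hv; pose proof PI_RGT_0.
  destruct (Rle_dec 0 v) as [H0 | H0].
  - rewrite <- cos_PI3; apply cos_decreasing_1; lra.
  - rewrite <- cos_neg, <- cos_PI3; apply cos_decreasing_1; lra.
Qed.

Lemma one_plus_cos_pos (v : R) : Rabs v <= 2 * PI / 3 -> 0 < 1 + cos v.
Proof.
  intros Hv; pose proof (cos_half_ge v Hv); rewrite (cos_half_angle v); nra.
Qed.

Lemma one_plus_2cos_nonneg (v : R) :
  Rabs v <= 2 * PI / 3 -> 0 <= 1 + 2 * cos v.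
Proof.
  intros Hv; pose proof (cos_half_ge v Hv); rewrite (cos_half_angle v); nra.
Qed.

Lemma one_plus_2cos_pos (v : R) : Rabs v < 2 * PI / 3 -> 0 < 1 + 2 * cos v.
Proof.
  intros Hv; pose proof (cos_half_gt v Hv); rewrite (cos_half_angle v); nra.
Qed.

Lemma sqrt_one_plus_cos (v : R) :
  Rabs v <= 2 * PI / 3 -> sqrt (1 + cos v) = sqrt 2 * cos (v / 2).
Proof.
  intros Hv; pose proof (cos_half_ge v Hv).
  rewrite (cos_half_angle v).
  replace (1 + (2 * cos (v / 2) ^ 2 - 1)) with (2 * cos (v / 2) ^ 2) by ring.
  rewrite sqrt_mult by nra. rewrite sqrt_pow2 by lra. reflexivity.
Qed.

Lemma root_pos (v : R) : Rabs v < 2 * PI / 3 -> 0 < sqrt (1 + 2 * cos v).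
Proof. intros Hv. now apply sqrt_lt_R0, one_plus_2cos_pos. Qed.

Lemma root_sq (v : R) :
  Rabs v <= 2 * PI / 3 ->
  sqrt (1 + 2 * cos v) ^ 2 = 4 * cos (v / 2) ^ 2 - 1.
Proof.
  intros Hv. pose proof (one_plus_2cos_nonneg v Hv).
  rewrite pow2_sqrt by lra. rewrite (cos_half_angle v). ring.
Qed.

Lemma sqrt3_sq : sqrt 3 ^ 2 = 3.
Proof. apply pow2_sqrt; lra. Qed.

Lemma sqrt3_pos : 0 < sqrt 3.
Proof. apply sqrt_lt_R0; lra. Qed.

(** With [p], [q] the sine and cosine of [v / 2] and [r = sqrt (1 + 2 cos v)],
    every quantity of the development over one cell is a rational function of
    [p], [q], [r], [sqrt 3], and the only relations needed are [p^2 = 1 - q^2],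
    [r^2 = 4 q^2 - 1] and [sqrt 3 ^ 2 = 3].  The tactic reduces an equation
    between such functions to a polynomial identity modulo these relations.
    Where a denominator contains [r], a hypothesis [0 < r] is expected in the
    context. *)
Ltac half_angle_identity v Hle :=
  let Hq := fresh "Hq" in let Hr2 := fresh "Hr2" in
  let Hp2 := fresh "Hp2" in let H3 := fresh "H3" in
  let p := fresh "p" in let q := fresh "q" in let r := fresh "r" in
  pose proof (cos_half_ge v Hle) as Hq;
  pose proof (root_sq v Hle) as Hr2;
  pose proof (sin_sq (v / 2)) as Hp2;
  pose proof sqrt3_sq as H3;
  set (r := sqrt (1 + 2 * cos v)) in *; clearbody r;
  rewrite ?(sin_half_angle v), ?(cos_half_angle v);
  set (p := sin (v / 2)) in *; set (q := cos (v / 2)) in *; clearbody p q;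
  field_simplify_eq [H3 Hp2 Hr2];
  [ring [H3 Hp2 Hr2] | repeat split; nra].

(** * Touching points on the developed rulings *)

(** The arc cosine of the statement in half-angle form, made odd in [v]. *)
Definition roll_angle (v : R) : R :=
  sign v * acos (2 * cos (v / 2) - / cos (v / 2)).

(** [start1], [start2] are the coordinates of the developed point [m = 0] and
    [dir1], [dir2] those of the vector from it to the developed point [m = 1],
    for a label in the cell around 0.  The formulas come from the parametrization
    to be established: [lambda = 0] gives the point [m = 0] and [lambda = 1] the
    point [m = 1] of each ruling. *)
Definition start1 (v : R) : R :=
  2 * sqrt 3 / 9 * (roll_angle v + 2 * sin (v / 2) * sqrt (1 + 2 * cos v)).
Definition start2 (v : R) : R :=
  sqrt 3 / 9 * (ln (2 / (1 + cos v)) + 4 - 4 * cos v).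
Definition dir1 (v : R) : R :=
  - (2 * sqrt 3 / 9) * sin (v / 2) * sqrt (1 + 2 * cos v)
    * (2 + / cos (v / 2) ^ 2).
Definition dir2 (v : R) : R :=
  sqrt 3 / 9 * (8 * cos (v / 2) ^ 2 - 1 + 2 / cos (v / 2) ^ 2).

(** The parameter of the touching point on its ruling: comparing the first
    coordinates [(1 - m) sin v] and [(1 - lambda) sin v / (1 + lambda cos v)]
    determines [m] where [sin v] is not zero. *)
Definition touching_m (lambda v : R) : R :=
  lambda * (1 + cos v) / (1 + lambda * cos v).

Lemma sign_sin_Rabs (v : R) :
  Rabs v <= 2 * PI / 3 -> sign v * Rabs (sin v) = sin v.
Proof.
  intros Hv; pose proof (cos_half_ge v Hv) as Hq.
  apply Rabs_le_between in Hv; pose proof PI_RGT_0.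
  destruct (Rtotal_order v 0) as [H0 | [H0 | H0]].
  - rewrite sign_eq_m1 by lra. rewrite Rabs_left; [ring|].
    rewrite <- (Ropp_involutive v), sin_neg.
    pose proof (sin_gt_0 (- v)); lra.
  - subst; rewrite sign_0, sin_0; ring.
  - rewrite sign_eq_1 by lra. rewrite Rabs_right; [ring|].
    pose proof (sin_gt_0 v); lra.
Qed.

(** For fixed [v] the claimed coordinates are fractional linear in [lambda] and
    become affine in [m = touching_m lambda v]; so the claim for all [lambda]
    is contained in its cases [lambda = 0] and [lambda = 1]. *)
Lemma kappa1_tilde_on_ruling (lambda v : R) :
  Rabs v <= 2 * PI / 3 -> 1 + lambda * cos v <> 0 ->
  sign v * kappa1_tilde lambda v
    = start1 v + touching_m lambda v * dir1 v.
Proof.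
  intros Hv Hp; pose proof (cos_half_ge v Hv) as Hq.
  pose proof (sign_sin_Rabs v Hv) as Hs.
  pose proof Rlt_sqrt2_0 as H2. pose proof (sqrt_sqrt 2 ltac:(lra)) as H2'.
  unfold kappa1_tilde, start1, dir1, roll_angle, touching_m; cbv zeta.
  rewrite sqrt_one_plus_cos by assumption.
  replace (sqrt 2 * cos v / (sqrt 2 * cos (v / 2)))
    with (2 * cos (v / 2) - / cos (v / 2))
    by (rewrite (cos_half_angle v); field; lra).
  rewrite sqrt_mult by (try lra; now apply one_plus_2cos_nonneg).
  transitivity (2 * sqrt 3 / 9 *
    (sign v * acos (2 * cos (v / 2) - / cos (v / 2)) +
     (1 - 2 * lambda) * (sign v * Rabs (sin v)) * sqrt (1 + 2 * cos v)
     / ((1 + lambda * cos v) * cos (v / 2)))).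
  { field. repeat split; lra. }
  rewrite Hs, (sin_half_angle v).
  rewrite (cos_half_angle v) in Hp. rewrite (cos_half_angle v).
  field. split; lra.
Qed.

Lemma kappa2_tilde_on_ruling (lambda v : R) :
  Rabs v <= 2 * PI / 3 -> 1 + lambda * cos v <> 0 ->
  kappa2_tilde lambda v = start2 v + touching_m lambda v * dir2 v.
Proof.
  intros Hv Hp; pose proof (cos_half_ge v Hv) as Hq.
  unfold kappa2_tilde, start2, dir2, touching_m; cbv zeta.
  set (l := ln _).
  rewrite (cos_half_angle v) in Hp. rewrite (cos_half_angle v).
  field. split; lra.
Qed.

(** * Motion of the developed ruling *)

Lemma acos_half_atan (y : R) :
  0 <= y -> acos ((1 - y ^ 2) / (1 + y ^ 2)) = 2 * atan y.
Proof.
  intros Hy.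
  assert (Ha : 0 <= atan y < PI / 2).
  { split; [|apply atan_bound]. rewrite <- atan_0.
    destruct (Rle_lt_or_eq_dec 0 y Hy) as [H|H].
    - left; now apply atan_increasing.
    - right; now rewrite H. }
  rewrite <- (acos_cos (2 * atan y)) by lra.
  f_equal. rewrite cos_2a_cos, cos_atan.
  pose proof (pow2_ge_0 y).
  assert (Hs : sqrt (1 + Rsqr y) ^ 2 = 1 + y ^ 2).
  { rewrite pow2_sqrt; unfold Rsqr; nra. }
  assert (0 < sqrt (1 + Rsqr y)) by (apply sqrt_lt_R0; unfold Rsqr; nra).
  transitivity (2 / sqrt (1 + Rsqr y) ^ 2 - 1).
  { rewrite Hs. field. lra. }
  field. lra.
Qed.

Lemma half_opp (v : R) : - v / 2 = - (v / 2).
Proof. field. Qed.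

Lemma roll_angle_opp (v : R) : roll_angle (- v) = - roll_angle v.
Proof.
  unfold roll_angle. rewrite half_opp, sign_opp, cos_neg. ring.
Qed.

(** The arc cosine is not differentiable where its argument is 1, that is at
    [v = 0], although its odd version is smooth there.  The half-angle
    tangent shows the smoothness. *)
Lemma roll_angle_atan (v : R) :
  Rabs v < 2 * PI / 3 ->
  roll_angle v = 2 * atan (sin (v / 2) * sqrt (1 + 2 * cos v)
                           / (cos (v / 2) + cos v)).
Proof.
  assert (Hpos : forall w, 0 < w < 2 * PI / 3 ->
    roll_angle w = 2 * atan (sin (w / 2) * sqrt (1 + 2 * cos w)
                           / (cos (w / 2) + cos w))).
  { intros w Hw. pose proof PI_RGT_0.
    assert (Hw' : Rabs w < 2 * PI / 3) by (rewrite Rabs_right; lra).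
    pose proof (cos_half_gt w Hw') as Hq.
    pose proof (one_plus_2cos_pos w Hw') as Hr.
    unfold roll_angle. rewrite sign_eq_1, Rmult_1_l by lra.
    assert (Hs : 0 < sin (w / 2)) by (apply sin_gt_0; lra).
    pose proof (sqrt_lt_R0 _ Hr) as Hr'.
    pose proof (sin_sq (w / 2)) as Hs2.
    pose proof (pow2_sqrt _ (Rlt_le _ _ Hr)) as Hr2.
    (* With q = cos (w / 2), the argument u = 2 q - 1 / q of acos and the argument
       y of atan are related by y^2 = (1 - u) / (1 + u). *)
    rewrite <- acos_half_atan.
    - f_equal.
      assert (Hy : (sin (w / 2) * sqrt (1 + 2 * cos w)
                    / (cos (w / 2) + cos w)) ^ 2
                 = (1 - cos (w / 2)) * (2 * cos (w / 2) + 1)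
                   / ((2 * cos (w / 2) - 1) * (cos (w / 2) + 1))).
      { transitivity (sin (w / 2) ^ 2 * sqrt (1 + 2 * cos w) ^ 2
                      / (cos (w / 2) + cos w) ^ 2).
        { field. rewrite (cos_half_angle w); nra. }
        rewrite Hs2, Hr2. rewrite (cos_half_angle w). field. nra. }
      rewrite Hy. field. nra.
    - rewrite (cos_half_angle w) in *.
      apply Rdiv_le_0_compat; nra. }
  intros Hv. apply Rabs_lt_between in Hv.
  destruct (Rtotal_order v 0) as [H0 | [H0 | H0]].
  - pose proof (Hpos (- v) ltac:(lra)) as P.
    rewrite roll_angle_opp, half_opp, sin_neg, !cos_neg in P.
    apply Ropp_eq_compat in P. rewrite Ropp_involutive in P. rewrite P.
    rewrite <- Ropp_mult_distr_r_reverse, <- atan_opp.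
    do 2 f_equal. unfold Rdiv. ring.
  - subst. unfold roll_angle. rewrite sign_0.
    replace (0 / 2) with 0 by field. rewrite sin_0.
    unfold Rdiv. rewrite !Rmult_0_l, atan_0. ring.
  - apply Hpos; lra.
Qed.

Lemma locally_Rabs_lt (a v : R) :
  Rabs v < a -> locally v (fun u => Rabs u < a).
Proof.
  intros Hv.
  apply (continuous_Rabs v (fun x => x < a)).
  now apply open_lt.
Qed.

Lemma is_derive_root (v : R) :
  Rabs v < 2 * PI / 3 ->
  is_derive (fun u => sqrt (1 + 2 * cos u)) v (- sin v / sqrt (1 + 2 * cos v)).
Proof.
  intros Hv. pose proof (root_pos v Hv) as Hr.
  pose proof (one_plus_2cos_pos v Hv).
  auto_derive; [lra | field; lra].
Qed.

Lemma is_derive_roll_angle (v : R) :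
  Rabs v < 2 * PI / 3 ->
  is_derive roll_angle v
    ((2 * cos (v / 2) ^ 2 + 1) / (2 * cos (v / 2) * sqrt (1 + 2 * cos v))).
Proof.
  intros Hv.
  apply is_derive_ext_loc with
    (fun u => 2 * atan (sin (u / 2) * sqrt (1 + 2 * cos u)
                        / (cos (u / 2) + cos u))).
  { apply filter_imp with (2 := locally_Rabs_lt _ _ Hv).
    intros u Hu. symmetry. now apply roll_angle_atan. }
  pose proof (cos_half_gt v Hv) as Hq.
  pose proof (root_pos v Hv) as Hr.
  pose proof (root_sq v (Rlt_le _ _ Hv)) as Hr2.
  pose proof (one_plus_2cos_pos v Hv).
  pose proof (sin_sq (v / 2)) as Hp2.
  assert (Hqc : 0 < cos (v / 2) + cos v)
    by (rewrite (cos_half_angle v); nra).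
  auto_derive; [repeat split; lra|].
  replace (v * / 2) with (v / 2) by reflexivity.
  set (r := sqrt (1 + 2 * cos v)) in *. clearbody r.
  rewrite (sin_half_angle v), (cos_half_angle v) in *.
  set (p := sin (v / 2)) in *. set (q := cos (v / 2)) in *.
  clearbody p q.
  assert (0 < (2 * q - 1) * (q + 1)) by nra.
  (* The square of the argument of atan is
     (1 - q) (2 q + 1) / ((2 q - 1) (q + 1)), because q + cos v factors as
     (2 q - 1) (q + 1); adding 1 leaves the numerator 2 q. *)
  replace (1 + (p * r / (q + (2 * q ^ 2 - 1))) ^ 2)
    with (2 * q * (2 * q - 1) * (q + 1) / ((2 * q - 1) * (q + 1)) ^ 2).
  2:{ field_simplify_eq; [| lra].
      ring_simplify. ring [Hp2 Hr2]. }
  field_simplify_eq [Hp2 Hr2]; [| repeat split; try lra; nra].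
  ring [Hp2 Hr2].
Qed.

Definition dstart1 (v : R) : R :=
  sqrt 3 / 9 * (sqrt (1 + 2 * cos v) ^ 3 / cos (v / 2)).
Definition dstart2 (v : R) : R :=
  sqrt 3 / 9 * (sin (v / 2) * (1 + 8 * cos (v / 2) ^ 2) / cos (v / 2)).
(** The angular velocity of the ruling: [(dir1, dir2)] has constant length, so
    its derivative is [turning] times its rotation by a quarter turn. *)
Definition turning (v : R) : R :=
  cos v / (cos (v / 2) * sqrt (1 + 2 * cos v)).

Lemma is_derive_start1 (v : R) :
  Rabs v < 2 * PI / 3 -> is_derive start1 v (dstart1 v).
Proof.
  intros Hv. pose proof (root_pos v Hv) as Hr.
  pose proof (is_derive_roll_angle v Hv) as D1.
  pose proof (is_derive_root v Hv) as D2.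
  unfold start1. evar_last.
  { apply (is_derive_scal
      (fun u => roll_angle u + 2 * sin (u / 2) * sqrt (1 + 2 * cos u))).
    apply (is_derive_plus roll_angle); [exact D1|].
    apply (is_derive_mult (fun u => 2 * sin (u / 2))
             (fun u => sqrt (1 + 2 * cos u)));
      [| exact D2 | intros; apply Rmult_comm].
    instantiate (1 := cos (v / 2)).
    auto_derive; [exact I|]. unfold Rdiv; field. }
  unfold plus, mult, dstart1; simpl; unfold mult; simpl.
  half_angle_identity v (Rlt_le _ _ Hv).
Qed.

Lemma is_derive_start2 (v : R) :
  Rabs v < 2 * PI / 3 -> is_derive start2 v (dstart2 v).
Proof.
  intros Hv. pose proof (cos_half_gt v Hv) as Hq.
  pose proof (one_plus_cos_pos v (Rlt_le _ _ Hv)) as Hc.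
  unfold start2, dstart2.
  auto_derive.
  { repeat split; [lra|]. apply Rdiv_lt_0_compat; lra. }
  rewrite (sin_half_angle v), (cos_half_angle v) in *.
  field. repeat split; lra.
Qed.

Lemma is_derive_dir1 (v : R) :
  Rabs v < 2 * PI / 3 -> is_derive dir1 v (- turning v * dir2 v).
Proof.
  intros Hv. pose proof (cos_half_gt v Hv) as Hq.
  pose proof (root_pos v Hv) as Hr. pose proof (one_plus_2cos_pos v Hv).
  unfold dir1, turning, dir2. auto_derive.
  { repeat split; trivial. apply Rgt_not_eq. unfold Rdiv in *. nra. }
  change (v * / 2) with (v / 2).
  half_angle_identity v (Rlt_le _ _ Hv).
Qed.

Lemma is_derive_dir2 (v : R) :
  Rabs v < 2 * PI / 3 -> is_derive dir2 v (turning v * dir1 v).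
Proof.
  intros Hv. pose proof (cos_half_gt v Hv) as Hq.
  pose proof (root_pos v Hv) as Hr. pose proof (one_plus_2cos_pos v Hv).
  unfold dir1, turning, dir2. auto_derive.
  { repeat split; trivial. apply Rgt_not_eq. unfold Rdiv in *. nra. }
  change (v * / 2) with (v / 2).
  half_angle_identity v (Rlt_le _ _ Hv).
Qed.

Lemma dir_norm (v : R) :
  Rabs v <= 2 * PI / 3 -> dir1 v ^ 2 + dir2 v ^ 2 = 3.
Proof.
  intros Hv. unfold dir1, dir2. half_angle_identity v Hv.
Qed.

Lemma dstart_norm (v : R) :
  Rabs v < 2 * PI / 3 -> dstart1 v ^ 2 + dstart2 v ^ 2 = 1.
Proof.
  intros Hv. unfold dstart1, dstart2.
  half_angle_identity v (Rlt_le _ _ Hv).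
Qed.

Lemma dir_dot_dstart (v : R) :
  Rabs v < 2 * PI / 3 ->
  dir1 v * dstart1 v + dir2 v * dstart2 v = sin (v / 2) / cos (v / 2).
Proof.
  intros Hv. unfold dstart1, dstart2, dir1, dir2.
  half_angle_identity v (Rlt_le _ _ Hv).
Qed.

(** The sign is negative: the point [m = 0] moves to the right of the oriented
    ruling, which at the label 0 is the side [xi > 0] of the eta-axis. *)
Lemma dir_det_dstart (v : R) :
  Rabs v < 2 * PI / 3 ->
  dir1 v * dstart2 v - dir2 v * dstart1 v
    = - (sqrt (1 + 2 * cos v) / cos (v / 2)).
Proof.
  intros Hv. unfold dstart1, dstart2, dir1, dir2.
  half_angle_identity v (Rlt_le _ _ Hv).
Qed.

(** * Cells of labels *)

(** Cell [k] is the interval of labels of width [4 PI / 3] centred at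
    [k * cell_width]; its endpoints are the labels that are not regular.  The
    closed cells overlap in these endpoints, where [shift] and [reduced_label]
    jump; formulas are stated on closed cells to express that the jumps cancel. *)
Definition cell_width : R := 4 * PI / 3.
Definition local_label (k : Z) (t : R) : R := t - IZR k * cell_width.
Definition in_cell (k : Z) (t : R) : Prop :=
  Rabs (local_label k t) <= 2 * PI / 3.
Definition inside_cell (k : Z) (t : R) : Prop :=
  Rabs (local_label k t) < 2 * PI / 3.

Lemma in_cell_cases (j k : Z) (t : R) :
  in_cell j t -> in_cell k t ->
  j = k \/ (j = (k + 1)%Z /\ local_label k t = 2 * PI / 3) \/
  (j = (k - 1)%Z /\ local_label k t = - (2 * PI / 3)).
Proof.
  unfold in_cell, local_label, cell_width; intros Hj Hk.
  apply Rabs_le_between in Hj; apply Rabs_le_between in Hk.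
  pose proof PI_RGT_0 as HPI.
  assert (Hd : -1 <= IZR (j - k) <= 1).
  { rewrite minus_IZR. split.
    - apply Rmult_le_reg_r with (4 * PI / 3); lra.
    - apply Rmult_le_reg_r with (4 * PI / 3); lra. }
  assert (Hz : (-1 <= j - k <= 1)%Z)
    by (split; apply le_IZR; lra).
  assert (Hc : (j = k \/ j = k + 1 \/ j = k - 1)%Z) by lia.
  destruct Hc as [-> | [-> | ->]]; [now left | right; left | right; right];
    split; trivial.
  - rewrite plus_IZR in Hj. lra.
  - rewrite minus_IZR in Hj. lra.
Qed.

Lemma in_cell_inside (j k : Z) (t : R) :
  in_cell j t -> inside_cell k t -> j = k.
Proof.
  intros Hj Hk. pose proof PI_RGT_0.
  destruct (in_cell_cases j k t Hj (Rlt_le _ _ Hk)) as [E | [[_ E] | [_ E]]];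
    [assumption | |]; unfold inside_cell in Hk; rewrite E in Hk;
    apply Rabs_lt_between in Hk; lra.
Qed.

Lemma shift_in_cell (t : R) :
  exists k : Z, shift t = IZR k /\ in_cell k t.
Proof.
  unfold shift, in_cell, local_label, cell_width. pose proof PI_RGT_0 as HPI.
  set (n := Int_part (3 * Rabs t / (4 * PI) + 1 / 2)).
  assert (Hn : Rabs (Rabs t - IZR n * (4 * PI / 3)) <= 2 * PI / 3).
  { destruct (base_Int_part (3 * Rabs t / (4 * PI) + 1 / 2)) as [H1 H2].
    fold n in H1, H2.
    assert (E : 3 * Rabs t / (4 * PI) * (4 * PI / 3) = Rabs t) by (field; lra).
    apply Rabs_le_between. split; nra. }
  destruct (Rtotal_order t 0) as [H | [H | H]].
  - exists (- n)%Z. rewrite opp_IZR, sign_eq_m1 by assumption.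
    rewrite (Rabs_left t H) in Hn. split; [ring|].
    rewrite <- Rabs_Ropp.
    replace (- (t - - IZR n * (4 * PI / 3)))
      with (- t - IZR n * (4 * PI / 3)) by ring. exact Hn.
  - exists 0%Z. subst t. rewrite sign_0. split; [ring|].
    replace (0 - 0 * (4 * PI / 3)) with 0 by ring. rewrite Rabs_R0. lra.
  - exists n. rewrite sign_eq_1 by assumption.
    rewrite (Rabs_right t) in Hn by lra. split; [ring | exact Hn].
Qed.

Lemma in_cell_zero : in_cell 0 0.
Proof.
  pose proof PI_RGT_0. unfold in_cell, local_label.
  rewrite Rmult_0_l, Rminus_0_r, Rabs_R0. lra.
Qed.

(** On an interior label every formula with a floor function is locally that
    of a single cell, and can be differentiated. *)
Lemma regular_inside (t : R) :
  regular_label t <-> exists k : Z, inside_cell k t.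
Proof.
  pose proof PI_RGT_0 as HPI. split.
  - intros Ht. destruct (shift_in_cell t) as [k [_ Hk]]. exists k.
    unfold in_cell in Hk. unfold inside_cell.
    destruct (Rle_lt_or_eq_dec _ _ Hk) as [H | H]; [exact H | exfalso].
    unfold local_label, cell_width in H.
    unfold Rabs in H. destruct (Rcase_abs _) as [N | N].
    + apply (Ht (k - 1)%Z). rewrite minus_IZR. lra.
    + apply (Ht k). lra.
  - intros [k Hk] j E. unfold inside_cell in Hk.
    assert (Hj : in_cell j t).
    { unfold in_cell, local_label, cell_width. rewrite E.
      apply Rabs_le_between. lra. }
    pose proof (in_cell_inside j k t Hj Hk) as ->.
    unfold local_label, cell_width in Hk. rewrite E in Hk.
    apply Rabs_lt_between in Hk. lra.
Qed.

Lemma locally_inside (k : Z) (t : R) :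
  inside_cell k t -> locally t (inside_cell k).
Proof.
  intros Hk. unfold inside_cell, local_label in *.
  assert (C : continuous (fun u => Rabs (u - IZR k * cell_width)) t).
  { apply continuous_Rabs_comp.
    apply (@ex_derive_continuous R_AbsRing R_NormedModule).
    auto_derive; trivial. }
  apply (C (fun x => x < 2 * PI / 3)). now apply open_lt.
Qed.

(** * The rulings in space *)

(** Even cells run over the rulings with [z = - omega3], odd cells backwards
    over those with [z = omega3].  Reversing the label changes the sign of [x],
    exchanging the sheets that of [z]: odd cells are the images of even ones
    under the half-turn about the y-axis. *)
Definition mirror (k : Z) : R := if Z.even k then 1 else -1.

Lemma mirror_succ (k : Z) : mirror (k + 1) = - mirror k.
Proof.
  unfold mirror. rewrite Z.add_1_r, Z.even_succ, <- Z.negb_even.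
  destruct (Z.even k); simpl; ring.
Qed.

Lemma mirror_pred (k : Z) : mirror (k - 1) = - mirror k.
Proof.
  pose proof (mirror_succ (k - 1)) as E. rewrite Z.sub_add in E. lra.
Qed.

(** A period of [reduced_label] consists of two cells, separated by the case
    distinction in [base_parameter] and [sheet]. *)
Lemma label_cell (t : R) :
  exists k : Z, in_cell k t /\
    base_parameter t = mirror k * local_label k t /\ sheet t = - mirror k.
Proof.
  unfold base_parameter, sheet, in_cell, local_label, cell_width.
  pose proof PI_RGT_0 as HPI.
  assert (HN : exists N : Z,
    reduced_label t = t - IZR N * (8 * PI / 3) /\
    - (2 * PI / 3) <= reduced_label t <= 2 * PI).
  { exists (Int_part ((t + 2 * PI / 3) / (8 * PI / 3))).
    split; [reflexivity|]. unfold reduced_label.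
    destruct (base_Int_part ((t + 2 * PI / 3) / (8 * PI / 3))) as [H1 H2].
    set (n := IZR (Int_part _)) in *.
    assert (E : (t + 2 * PI / 3) / (8 * PI / 3) * (8 * PI / 3)
                = t + 2 * PI / 3) by (field; lra).
    split; nra. }
  destruct HN as [N [E HN]].
  destruct (Rle_dec (reduced_label t) (2 * PI / 3)) as [H | H].
  - exists (2 * N)%Z. unfold mirror. rewrite Z.even_mul. simpl Z.even.
    rewrite mult_IZR. cbn [orb].
    split; [apply Rabs_le_between | split]; lra.
  - exists (2 * N + 1)%Z. unfold mirror.
    rewrite Z.add_1_r, Z.even_succ, <- Z.negb_even, Z.even_mul. simpl Z.even.
    rewrite <- Z.add_1_r, plus_IZR, mult_IZR. cbn [orb negb].
    split; [apply Rabs_le_between | split]; lra.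
Qed.

Lemma cos_cell_end : cos (2 * PI / 3) = - (1 / 2).
Proof.
  replace (2 * PI / 3) with (2 * (PI / 3)) by field. rewrite cos_2PI3. lra.
Qed.

Lemma base_parameter_in_cell (k : Z) (t : R) :
  in_cell k t -> base_parameter t = mirror k * local_label k t.
Proof.
  intros Hk. destruct (label_cell t) as [j [Hj [-> _]]].
  destruct (in_cell_cases j k t Hj Hk) as [-> | [[-> E] | [-> E]]];
    [reflexivity | rewrite mirror_succ | rewrite mirror_pred];
    unfold local_label in *; rewrite ?plus_IZR, ?minus_IZR;
    unfold cell_width in *.
  - replace t with (2 * PI / 3 + IZR k * (4 * PI / 3)) by lra. field.
  - replace t with (- (2 * PI / 3) + IZR k * (4 * PI / 3)) by lra. field.
Qed.

Lemma cos_base_parameter (k : Z) (t : R) :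
  in_cell k t -> cos (base_parameter t) = cos (local_label k t).
Proof.
  intros Hk. rewrite (base_parameter_in_cell k t Hk).
  unfold mirror; destruct (Z.even k); rewrite ?Rmult_1_l; trivial.
  rewrite <- (cos_neg (local_label k t)). f_equal. ring.
Qed.

Lemma sin_base_parameter (k : Z) (t : R) :
  in_cell k t -> sin (base_parameter t) = mirror k * sin (local_label k t).
Proof.
  intros Hk. rewrite (base_parameter_in_cell k t Hk).
  unfold mirror; destruct (Z.even k); rewrite ?Rmult_1_l; trivial.
  transitivity (sin (- local_label k t)); [f_equal; ring|].
  rewrite sin_neg; ring.
Qed.

(** The factor [sqrt (1 + 2 cos)] makes the two sheets meet at the ends of the
    cells, where the index of the cell does not determine [sheet]. *)
Lemma sheet_in_cell (k : Z) (t : R) :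
  in_cell k t ->
  sheet t * sqrt (1 + 2 * cos (local_label k t))
    = - mirror k * sqrt (1 + 2 * cos (local_label k t)).
Proof.
  intros Hk. destruct (label_cell t) as [j [Hj [_ ->]]].
  destruct (in_cell_cases j k t Hj Hk) as [-> | [[_ E] | [_ E]]];
    [reflexivity | |]; rewrite E, ?cos_neg, cos_cell_end;
    replace (1 + 2 * - (1 / 2)) with 0 by field; rewrite sqrt_0; ring.
Qed.

Definition cell_ruling (k : Z) (m v : R) : vec3 :=
  (mirror k * omega1 m v, omega2 m v, - mirror k * omega3 m v).

Lemma oloid_in_cell (k : Z) (m t : R) :
  in_cell k t -> oloid m t = cell_ruling k m (local_label k t).
Proof.
  intros Hk. unfold oloid, cell_ruling, omega1, omega2, omega3; cbv zeta.
  rewrite (cos_base_parameter k), (sin_base_parameter k) by assumption.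
  f_equal; [f_equal; ring|].
  unfold Rdiv. pose proof (sheet_in_cell k t Hk) as E.
  transitivity (m * / (1 + cos (local_label k t))
    * (sheet t * sqrt (1 + 2 * cos (local_label k t)))); [ring|].
  rewrite E; ring.
Qed.

Lemma touching_point_on_ruling (lambda t : R) :
  ~ touching_pole lambda t ->
  touching_point lambda t
    = oloid (touching_m lambda (base_parameter t)) t.
Proof.
  unfold touching_pole; intros Hp.
  unfold touching_point, oloid, kappa1, kappa2, kappa3,
    omega1, omega2, omega3, touching_m; cbv zeta.
  destruct (label_cell t) as [k [Hk _]].
  assert (Hc : 0 < 1 + cos (base_parameter t)).
  { rewrite (cos_base_parameter k t Hk). now apply one_plus_cos_pos. }
  f_equal; [f_equal |]; field; lra.
Qed.

(** The segments between the two circles all have length [sqrt 3]. *)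
Lemma distance3_ruling (m m' t : R) :
  distance3 (oloid m t) (oloid m' t) = sqrt 3 * Rabs (m - m').
Proof.
  destruct (label_cell t) as [k [Hk _]].
  rewrite !(oloid_in_cell k) by assumption.
  unfold in_cell in Hk. set (v := local_label k t) in *.
  rewrite <- sqrt_Rsqr_abs, <- sqrt_mult by (try lra; apply Rle_0_sqr).
  unfold distance3, cell_ruling, omega1, omega2, omega3, px, py, pz, Rsqr;
    cbn [fst snd].
  f_equal.
  unfold mirror; destruct (Z.even k); half_angle_identity v Hk.
Qed.

Lemma d_m3_oloid (k : Z) (m t : R) :
  inside_cell k t ->
  let v := local_label k t in
  d_m3 oloid m t =
    (- mirror k * sin v, (1 + cos v + cos v ^ 2) / (1 + cos v),
     - mirror k * (sqrt (1 + 2 * cos v) / (1 + cos v))).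
Proof.
  intros Hk v. pose proof (one_plus_cos_pos v (Rlt_le _ _ Hk)) as Hc.
  unfold d_m3. f_equal; [f_equal|]; apply is_derive_unique;
    (eapply is_derive_ext; [intros u; rewrite (oloid_in_cell k)
       by (now apply Rlt_le); reflexivity|]); fold v;
    unfold cell_ruling, omega1, omega2, omega3, px, py, pz; cbn [fst snd];
    (auto_derive; [trivial|]); try field; lra.
Qed.

Lemma is_derive_local_label (f : R -> R) (k : Z) (t l : R) :
  is_derive f (local_label k t) l ->
  is_derive (fun u => f (local_label k u)) t l.
Proof.
  intros Hf. evar_last.
  - apply (is_derive_comp f (local_label k)); [exact Hf|].
    unfold local_label. instantiate (1 := 1). auto_derive; trivial; ring.
  - apply Rmult_1_l.
Qed.

Lemma d_t3_oloid (k : Z) (m t : R) :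
  inside_cell k t ->
  let v := local_label k t in
  d_t3 oloid m t =
    (mirror k * ((1 - m) * cos v),
     (1 - m) * sin v + m * sin v / (1 + cos v) ^ 2,
     - mirror k * (m * sin v * cos v
       / (sqrt (1 + 2 * cos v) * (1 + cos v) ^ 2))).
Proof.
  intros Hk v. pose proof (one_plus_cos_pos v (Rlt_le _ _ Hk)) as Hc.
  pose proof (one_plus_2cos_pos v Hk) as Hr.
  pose proof (sqrt_lt_R0 _ Hr) as Hr'.
  pose proof (pow2_sqrt _ (Rlt_le _ _ Hr)) as Hr2.
  unfold d_t3.
  f_equal; [f_equal|]; apply is_derive_unique;
    (eapply is_derive_ext_loc;
      [apply filter_imp with (2 := locally_inside k t Hk);
       intros u Hu; rewrite (oloid_in_cell k) by (now apply Rlt_le);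
       unfold cell_ruling, px, py, pz; cbn [fst snd]; reflexivity |]).
  - apply (is_derive_local_label (fun u => mirror k * omega1 m u)); fold v.
    unfold omega1; auto_derive; trivial; ring.
  - apply (is_derive_local_label (omega2 m)); fold v.
    unfold omega2; auto_derive; [lra | field; lra].
  - apply (is_derive_local_label (fun u => - mirror k * omega3 m u)); fold v.
    unfold omega3; auto_derive; [repeat split; lra|].
    set (r := sqrt (1 + 2 * cos v)) in *. clearbody r.
    field_simplify_eq [Hr2]; [| lra]. ring [Hr2].
Qed.

(** * The explicit development *)

(** Each cell contributes a copy of the first one, translated along the xi-axis
    by [4 PI / (3 sqrt 3)] per cell. *)
Definition unrolled (m t : R) : vec2 :=
  (shift t * (4 * PI / (3 * sqrt 3)) + (start1 (h t) + m * dir1 (h t)),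
   start2 (h t) + m * dir2 (h t)).

Lemma roll_angle_end : roll_angle (2 * PI / 3) = PI.
Proof.
  pose proof PI_RGT_0. unfold roll_angle.
  replace (2 * PI / 3 / 2) with (PI / 3) by field.
  rewrite cos_PI3, sign_eq_1 by lra.
  replace (2 * (1 / 2) - / (1 / 2)) with (- (1)) by field.
  rewrite acos_opp, acos_1. ring.
Qed.

Lemma start1_opp (v : R) : start1 (- v) = - start1 v.
Proof.
  unfold start1. rewrite roll_angle_opp, half_opp, cos_neg, sin_neg. ring.
Qed.

Lemma start2_opp (v : R) : start2 (- v) = start2 v.
Proof. unfold start2. now rewrite cos_neg. Qed.

Lemma dir1_opp (v : R) : dir1 (- v) = - dir1 v.
Proof. unfold dir1. rewrite half_opp, !cos_neg, sin_neg. ring. Qed.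

Lemma dir2_opp (v : R) : dir2 (- v) = dir2 v.
Proof. unfold dir2. now rewrite half_opp, cos_neg. Qed.

Lemma root_end : sqrt (1 + 2 * cos (2 * PI / 3)) = 0.
Proof.
  rewrite cos_cell_end. replace (1 + 2 * - (1 / 2)) with 0 by field.
  apply sqrt_0.
Qed.

(** Consecutive translated copies fit together: the two ends of a cell are one
    translation apart, and the rulings there are parallel to the eta-axis
    ([dir1_end]). *)
Lemma start1_end : 2 * start1 (2 * PI / 3) = 4 * PI / (3 * sqrt 3).
Proof.
  unfold start1. rewrite roll_angle_end, root_end.
  pose proof sqrt3_sq as H3. pose proof sqrt3_pos.
  field_simplify_eq [H3]; [| lra]. ring [H3].
Qed.

Lemma dir1_end : dir1 (2 * PI / 3) = 0.
Proof. unfold dir1. rewrite root_end. ring. Qed.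

(** At a common endpoint of two cells, [shift] selects one of them; the parity
    of the four functions and their values at the ends give the same point in
    terms of the other. *)
Lemma unrolled_in_cell (k : Z) (m t : R) :
  in_cell k t ->
  let v := local_label k t in
  unrolled m t =
    (IZR k * (4 * PI / (3 * sqrt 3)) + (start1 v + m * dir1 v),
     start2 v + m * dir2 v).
Proof.
  intros Hk v. destruct (shift_in_cell t) as [j [Es Hj]].
  unfold unrolled, h. rewrite Es. fold cell_width.
  change (t - IZR j * cell_width) with (local_label j t).
  pose proof start1_end as E1. pose proof dir1_end as E2.
  destruct (in_cell_cases j k t Hj Hk) as [-> | [[-> E] | [-> E]]];
    [reflexivity | |]; subst v.
  - assert (E' : local_label (k + 1) t = - (2 * PI / 3)).
    { unfold local_label, cell_width in *. rewrite plus_IZR. lra. }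
    rewrite E, E', start1_opp, start2_opp, dir1_opp, dir2_opp, E2, plus_IZR.
    f_equal. rewrite <- E1. ring.
  - assert (E' : local_label (k - 1) t = 2 * PI / 3).
    { unfold local_label, cell_width in *. rewrite minus_IZR. lra. }
    rewrite E, E', start1_opp, start2_opp, dir1_opp, dir2_opp, E2, minus_IZR.
    f_equal. rewrite <- E1. ring.
Qed.

Lemma h_in_cell (t : R) :
  exists k : Z, in_cell k t /\ shift t = IZR k /\ h t = local_label k t.
Proof.
  destruct (shift_in_cell t) as [k [Es Hk]]. exists k.
  repeat split; trivial. unfold h. now rewrite Es.
Qed.

(** * Continuity of the explicit development *)

(** At the ends of the cells the argument of [acos] is -1.  There
    [acos x = PI - acos (- x)] is expressed by [atan] and a square root that is
    continuous, though not differentiable. *)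
Lemma continuous_acos_m1 : continuous acos (-1).
Proof.
  apply continuous_ext_loc with
    (fun x => PI - atan (sqrt (1 - Rsqr x) / (- x))).
  { apply filter_imp with (fun x => x < 0).
    - intros x Hx. transitivity (acos (- - x)); [|now rewrite Ropp_involutive].
      now rewrite acos_opp, (acos_atan (- x)), <- Rsqr_neg by lra.
    - apply open_lt. lra. }
  apply (continuous_minus (V := R_NormedModule)).
  - apply continuous_const.
  - apply continuous_atan_comp. unfold Rdiv.
    apply (continuous_mult (K := R_AbsRing)).
    + apply continuous_sqrt_comp.
      apply (@ex_derive_continuous R_AbsRing R_NormedModule).
      unfold Rsqr. auto_derive; trivial.
    + apply (@ex_derive_continuous R_AbsRing R_NormedModule).
      auto_derive; lra.
Qed.

Lemma continuous_roll_angle (v : R) :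
  Rabs v <= 2 * PI / 3 -> continuous roll_angle v.
Proof.
  intros Hv.
  assert (Hend : continuous roll_angle (2 * PI / 3)).
  { pose proof PI_RGT_0.
    apply continuous_ext_loc with
      (fun u => acos (2 * cos (u / 2) - / cos (u / 2))).
    { apply filter_imp with (fun u => 0 < u).
      - intros u Hu. unfold roll_angle. now rewrite sign_eq_1, Rmult_1_l.
      - apply open_gt. lra. }
    apply (continuous_comp (fun u => 2 * cos (u / 2) - / cos (u / 2)) acos).
    - apply (@ex_derive_continuous R_AbsRing R_NormedModule).
      auto_derive. change (2 * PI / 3 * / 2) with (2 * PI / 3 / 2).
      replace (2 * PI / 3 / 2) with (PI / 3) by field. rewrite cos_PI3. lra.
    - replace (2 * cos (2 * PI / 3 / 2) - / cos (2 * PI / 3 / 2)) with (-1).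
      + apply continuous_acos_m1.
      + replace (2 * PI / 3 / 2) with (PI / 3) by field. rewrite cos_PI3. lra. }
  destruct (Rle_lt_or_eq_dec _ _ Hv) as [H | H].
  - apply (@ex_derive_continuous R_AbsRing R_NormedModule).
    eexists. now apply is_derive_roll_angle.
  - destruct (Rle_dec 0 v) as [H0 | H0].
    + rewrite Rabs_right in H by lra. now rewrite H.
    + rewrite Rabs_left in H by lra.
      apply continuous_ext with (fun u => - roll_angle (- u)).
      { intros u. rewrite roll_angle_opp. apply Ropp_involutive. }
      apply (continuous_opp (V := R_NormedModule) (fun u => roll_angle (- u))).
      apply (continuous_comp Ropp roll_angle).
      * apply (continuous_opp (V := R_NormedModule) (fun u => u)).
        apply continuous_id.
      * now rewrite H.
Qed.

Lemma continuous_half_root (v : R) :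
  continuous (fun u => sin (u / 2) * sqrt (1 + 2 * cos u)) v.
Proof.
  apply (continuous_mult (K := R_AbsRing)).
  - apply (@ex_derive_continuous R_AbsRing R_NormedModule).
    auto_derive; trivial.
  - apply continuous_sqrt_comp.
    apply (@ex_derive_continuous R_AbsRing R_NormedModule).
    auto_derive; trivial.
Qed.

Lemma continuous_ruling1 (m v : R) :
  Rabs v <= 2 * PI / 3 -> continuous (fun u => start1 u + m * dir1 u) v.
Proof.
  intros Hv. pose proof (cos_half_ge v Hv) as Hq.
  apply continuous_ext with
    (fun u => 2 * sqrt 3 / 9 * roll_angle u
       + (sin (u / 2) * sqrt (1 + 2 * cos u))
         * (2 * sqrt 3 / 9 * (2 - m * (2 + / cos (u / 2) ^ 2)))).
  { intros u. unfold start1, dir1.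
    match goal with |- ?a = ?b => change (@eq R a b) end. ring. }
  apply (continuous_plus (V := R_NormedModule)).
  - apply (continuous_scal_r (V := R_NormedModule)).
    now apply continuous_roll_angle.
  - apply (continuous_mult (K := R_AbsRing)).
    + apply continuous_half_root.
    + apply (@ex_derive_continuous R_AbsRing R_NormedModule).
      auto_derive. apply Rgt_not_eq. unfold Rdiv in Hq. nra.
Qed.

Lemma continuous_ruling2 (m v : R) :
  Rabs v <= 2 * PI / 3 -> continuous (fun u => start2 u + m * dir2 u) v.
Proof.
  intros Hv. pose proof (cos_half_ge v Hv) as Hq.
  pose proof (one_plus_cos_pos v Hv) as Hc.
  apply (@ex_derive_continuous R_AbsRing R_NormedModule).
  unfold start2, dir2. auto_derive. repeat split; try lra.
  - apply Rdiv_lt_0_compat; lra.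
  - apply Rgt_not_eq. unfold Rdiv in Hq. nra.
Qed.

Lemma continuous_glue (f g1 g2 : R -> R) (x : R) :
  continuous g1 x -> continuous g2 x -> f x = g1 x -> f x = g2 x ->
  locally x (fun u => f u = g1 u \/ f u = g2 u) -> continuous f x.
Proof.
  intros C1 C2 E1 E2 Hl P HP.
  assert (P1 : locally (g1 x) P) by now rewrite <- E1.
  assert (P2 : locally (g2 x) P) by now rewrite <- E2.
  specialize (C1 P P1). specialize (C2 P P2).
  unfold filtermap in *.
  apply (filter_imp (fun u => (P (g1 u) /\ P (g2 u))
                              /\ (f u = g1 u \/ f u = g2 u))).
  - intros u [[Q1 Q2] [-> | ->]]; assumption.
  - repeat apply filter_and; assumption.
Qed.

Lemma locally_two_cells (t : R) :
  exists j k : Z, in_cell j t /\ in_cell k t /\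
    locally t (fun u => in_cell j u \/ in_cell k u).
Proof.
  pose proof PI_RGT_0 as HPI.
  destruct (shift_in_cell t) as [k [_ Hk]].
  destruct (Rle_lt_or_eq_dec _ _ Hk) as [H | H].
  - exists k, k. repeat split; trivial.
    apply filter_imp with (2 := locally_inside k t H).
    intros u Hu. left. now apply Rlt_le.
  - assert (Hj : exists j : Z, in_cell j t /\
        forall u : R, Rabs (u - t) < cell_width -> in_cell j u \/ in_cell k u).
    { unfold in_cell, local_label, cell_width in *.
      destruct (Rle_dec 0 (t - IZR k * (4 * PI / 3))) as [H0 | H0].
      - rewrite Rabs_right in H by lra. exists (k + 1)%Z.
        rewrite plus_IZR. split; [apply Rabs_le_between; lra|].
        intros u Hu. apply Rabs_lt_between in Hu. rewrite !Rabs_le_between. lra.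
      - rewrite Rabs_left in H by lra. exists (k - 1)%Z.
        rewrite minus_IZR. split; [apply Rabs_le_between; lra|].
        intros u Hu. apply Rabs_lt_between in Hu.
        rewrite !Rabs_le_between. lra. }
    destruct Hj as [j [Hjt Hj]].
    assert (Hw : 0 < cell_width) by (unfold cell_width; lra).
    exists j, k. repeat split; trivial.
    exists (mkposreal _ Hw). intros u Hu. apply Hj. exact Hu.
Qed.

Lemma continuous_local_label (f : R -> R) (k : Z) (t : R) :
  continuous f (local_label k t) ->
  continuous (fun u => f (local_label k u)) t.
Proof.
  intros Hf. apply (continuous_comp (local_label k) f); [|exact Hf].
  apply (@ex_derive_continuous R_AbsRing R_NormedModule).
  unfold local_label. auto_derive; trivial.
Qed.

Lemma continuous_unrolled (m t : R) :
  continuous (fun u => xi (unrolled m u)) t /\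
  continuous (fun u => eta (unrolled m u)) t.
Proof.
  destruct (locally_two_cells t) as [j [k [Hj [Hk Hl]]]]. split.
  - set (g := fun (i : Z) u => IZR i * (4 * PI / (3 * sqrt 3))
           + (start1 (local_label i u) + m * dir1 (local_label i u))).
    assert (Hg : forall i u, in_cell i u -> xi (unrolled m u) = g i u)
      by (intros i u Hi; now rewrite (unrolled_in_cell i)).
    assert (Cg : forall i, in_cell i t -> continuous (g i) t).
    { intros i Hi. apply (continuous_plus (V := R_NormedModule)).
      - apply continuous_const.
      - apply (continuous_local_label (fun v => start1 v + m * dir1 v)).
        now apply continuous_ruling1. }
    apply (continuous_glue _ (g j) (g k)); auto.
    apply filter_imp with (2 := Hl). intros u [Hu | Hu]; auto.
  - set (g := fun (i : Z) u =>
           start2 (local_label i u) + m * dir2 (local_label i u)).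
    assert (Hg : forall i u, in_cell i u -> eta (unrolled m u) = g i u)
      by (intros i u Hi; now rewrite (unrolled_in_cell i)).
    assert (Cg : forall i, in_cell i t -> continuous (g i) t).
    { intros i Hi.
      apply (continuous_local_label (fun v => start2 v + m * dir2 v)).
      now apply continuous_ruling2. }
    apply (continuous_glue _ (g j) (g k)); auto.
    apply filter_imp with (2 := Hl). intros u [Hu | Hu]; auto.
Qed.

(** * Isometry of the explicit development *)

Lemma distance2_unrolled (m m' t : R) :
  distance2 (unrolled m t) (unrolled m' t) = sqrt 3 * Rabs (m - m').
Proof.
  destruct (h_in_cell t) as [k [Hk [_ Eh]]].
  rewrite <- sqrt_Rsqr_abs, <- sqrt_mult by (try lra; apply Rle_0_sqr).
  unfold distance2, unrolled, xi, eta, Rsqr; cbn [fst snd].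
  f_equal. rewrite <- (dir_norm (h t)) by now rewrite Eh. ring.
Qed.

Lemma is_derive_unrolled (k : Z) (m t : R) :
  inside_cell k t ->
  let v := local_label k t in
  is_derive (fun u => xi (unrolled m u)) t
    (dstart1 v - m * (turning v * dir2 v)) /\
  is_derive (fun u => eta (unrolled m u)) t
    (dstart2 v + m * (turning v * dir1 v)).
Proof.
  intros Hk v.
  pose proof (is_derive_start1 v Hk) as D1.
  pose proof (is_derive_start2 v Hk) as D2.
  pose proof (is_derive_dir1 v Hk) as D3.
  pose proof (is_derive_dir2 v Hk) as D4.
  split;
    (eapply is_derive_ext_loc;
      [apply filter_imp with (2 := locally_inside k t Hk);
       intros u Hu; rewrite (unrolled_in_cell k) by (now apply Rlt_le);
       unfold xi, eta; cbn [fst snd]; reflexivity |]).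
  - apply (is_derive_local_label
      (fun u => IZR k * (4 * PI / (3 * sqrt 3)) + (start1 u + m * dir1 u))).
    fold v. evar_last.
    + apply (is_derive_plus (V := R_NormedModule)); [apply is_derive_const|].
      apply (is_derive_plus (V := R_NormedModule)); [exact D1|].
      apply is_derive_scal. exact D3.
    + unfold plus, zero; simpl. ring.
  - apply (is_derive_local_label (fun u => start2 u + m * dir2 u)).
    fold v. evar_last.
    + apply (is_derive_plus (V := R_NormedModule)); [exact D2|].
      apply is_derive_scal. exact D4.
    + unfold plus; simpl. ring.
Qed.

Lemma d_t2_unrolled (k : Z) (m t : R) :
  inside_cell k t ->
  let v := local_label k t in
  d_t2 unrolled m t = (dstart1 v - m * (turning v * dir2 v),
                       dstart2 v + m * (turning v * dir1 v)).
Proof.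
  intros Hk v. destruct (is_derive_unrolled k m t Hk) as [D1 D2].
  unfold d_t2. f_equal; now apply is_derive_unique.
Qed.

Lemma d_m2_unrolled (k : Z) (m t : R) :
  in_cell k t ->
  let v := local_label k t in d_m2 unrolled m t = (dir1 v, dir2 v).
Proof.
  intros Hk v. unfold d_m2. f_equal; apply is_derive_unique;
    (eapply is_derive_ext;
      [intros u; rewrite (unrolled_in_cell k) by assumption;
       unfold xi, eta; cbn [fst snd]; reflexivity|]);
    fold v; auto_derive; trivial; ring.
Qed.

(** The determinant vanishes on the edge of regression, where the numerator is
    zero. *)
Lemma det_unrolled (k : Z) (m t : R) :
  inside_cell k t ->
  let v := local_label k t in
  det2 (d_m2 unrolled m t) (d_t2 unrolled m t)
    = - (1 + (2 - 3 * m) * cos v)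
        / (cos (v / 2) * sqrt (1 + 2 * cos v)).
Proof.
  intros Hk v. rewrite (d_m2_unrolled k), (d_t2_unrolled k)
    by (try apply Rlt_le; assumption).
  fold v. unfold det2, xi, eta; cbn [fst snd].
  pose proof (root_pos v Hk) as Hr.
  transitivity ((dir1 v * dstart2 v - dir2 v * dstart1 v)
                + m * turning v * (dir1 v ^ 2 + dir2 v ^ 2)); [ring|].
  rewrite dir_norm by now apply Rlt_le. rewrite dir_det_dstart by assumption.
  unfold turning. half_angle_identity v (Rlt_le _ _ Hk).
Qed.

(** The numerator [1 + (2 - 3 m) cos v] is affine in [m], with the values
    [1 + 2 cos v > 0] at [m = 0] and [1 - cos v >= 0] at [m = 1]. *)
Lemma det_unrolled_neg (m t : R) :
  0 < m < 1 -> regular_label t ->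
  det2 (d_m2 unrolled m t) (d_t2 unrolled m t) < 0.
Proof.
  intros Hm Ht. apply regular_inside in Ht. destruct Ht as [k Hk].
  rewrite (det_unrolled k) by assumption.
  set (v := local_label k t).
  pose proof (cos_half_gt v Hk) as Hq.
  pose proof (root_pos v Hk) as Hr.
  pose proof (one_plus_2cos_pos v Hk). pose proof (COS_bound v).
  assert (0 < 1 + (2 - 3 * m) * cos v) by nra.
  assert (0 < (1 + (2 - 3 * m) * cos v)
              / (cos (v / 2) * sqrt (1 + 2 * cos v)))
    by (apply Rdiv_lt_0_compat; nra).
  unfold Rdiv in *. lra.
Qed.

(** In the plane, the derivative along [t] is that of the start plus
    [m turning] times a quarter turn of the ruling; so the first fundamental form reduces to the
    dot products and the determinant of the ruling and the velocity of its
    start.  In space, [mirror k] disappears because the cells are congruent. *)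
Lemma isometry_unrolled (m t : R) :
  regular_label t ->
  dot2 (d_m2 unrolled m t) (d_m2 unrolled m t)
    = dot3 (d_m3 oloid m t) (d_m3 oloid m t) /\
  dot2 (d_m2 unrolled m t) (d_t2 unrolled m t)
    = dot3 (d_m3 oloid m t) (d_t3 oloid m t) /\
  dot2 (d_t2 unrolled m t) (d_t2 unrolled m t)
    = dot3 (d_t3 oloid m t) (d_t3 oloid m t).
Proof.
  intros Ht. apply regular_inside in Ht. destruct Ht as [k Hk].
  rewrite (d_m2_unrolled k), (d_t2_unrolled k), (d_m3_oloid k), (d_t3_oloid k)
    by (try apply Rlt_le; assumption).
  set (v := local_label k t).
  unfold dot2, dot3, xi, eta, px, py, pz; cbn [fst snd].
  pose proof (dir_norm v (Rlt_le _ _ Hk)) as N1.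
  pose proof (dstart_norm v Hk) as N2.
  pose proof (dir_dot_dstart v Hk) as N3.
  pose proof (dir_det_dstart v Hk) as N4.
  pose proof (root_pos v Hk) as Hr.
  repeat split.
  - transitivity 3; [rewrite <- N1; ring|].
    unfold mirror; destruct (Z.even k);
      half_angle_identity v (Rlt_le _ _ Hk).
  - transitivity (sin (v / 2) / cos (v / 2)); [rewrite <- N3; ring|].
    unfold mirror; destruct (Z.even k);
      half_angle_identity v (Rlt_le _ _ Hk).
  - transitivity ((dstart1 v ^ 2 + dstart2 v ^ 2)
      + 2 * m * turning v * (dir1 v * dstart2 v - dir2 v * dstart1 v)
      + m ^ 2 * turning v ^ 2 * (dir1 v ^ 2 + dir2 v ^ 2)); [ring|].
    rewrite N1, N2, N4. unfold turning, mirror. destruct (Z.even k);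
      half_angle_identity v (Rlt_le _ _ Hk).
Qed.

Lemma unrolled_start (m : R) : unrolled m 0 = (0, m * sqrt 3).
Proof.
  rewrite (unrolled_in_cell 0 m 0 in_cell_zero).
  assert (E : local_label 0 0 = 0) by (unfold local_label; ring).
  rewrite E. unfold start1, start2, dir1, dir2, roll_angle.
  replace (0 / 2) with 0 by field.
  rewrite sign_0, sin_0, cos_0.
  replace (2 / (1 + 1)) with 1 by field. rewrite ln_1.
  f_equal; field.
  pose proof sqrt3_pos; lra.
Qed.

(** With [p], [r] as above and [i = / cos (t / 2) ^ 2], the coordinate is a
    positive multiple of [roll_angle t + p r (2 - m (2 + i))].  Both terms are
    nonnegative and the second one is positive, since [m < 1 / 2] and
    [i < 2]. *)
Lemma unrolled_xi_pos (m t : R) :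
  Rabs m < 1 / 2 -> 0 < t < 1 / 2 -> 0 < xi (unrolled m t).
Proof.
  intros Hm Ht. pose proof PI2_1 as HPI. apply Rabs_lt_between in Hm.
  assert (E : local_label 0 t = t) by (unfold local_label; ring).
  assert (Hk : Rabs t < 2 * PI / 3) by (apply Rabs_lt_between; lra).
  rewrite (unrolled_in_cell 0 m t)
    by (unfold in_cell; rewrite E; now apply Rlt_le).
  rewrite E. unfold xi; cbn [fst].
  pose proof (cos_half_gt t Hk) as Hq.
  pose proof (root_pos t Hk) as Hr.
  assert (Hc : 0 < cos t) by (apply cos_gt_0; lra).
  rewrite (cos_half_angle t) in Hc.
  assert (Hp : 0 < sin (t / 2)) by (apply sin_gt_0; lra).
  assert (Ha : 0 <= roll_angle t).
  { unfold roll_angle. rewrite sign_eq_1, Rmult_1_l by lra.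
    apply acos_bound. }
  pose proof sqrt3_pos as H3.
  unfold start1, dir1.
  assert (Hi : 0 < / cos (t / 2) ^ 2 < 2).
  { split; [apply Rinv_0_lt_compat; nra|].
    apply Rmult_lt_reg_l with (cos (t / 2) ^ 2); [nra|].
    rewrite Rinv_r; nra. }
  set (i := / cos (t / 2) ^ 2) in *. set (r := sqrt (1 + 2 * cos t)) in *.
  set (p := sin (t / 2)) in *. clearbody i r p.
  replace (IZR 0 * _ + _) with
    (2 * sqrt 3 / 9 * (roll_angle t + p * r * (2 - m * (2 + i)))) by ring.
  assert (0 < 2 - m * (2 + i)) by nra.
  assert (0 < p * r) by nra.
  assert (0 < p * r * (2 - m * (2 + i))) by nra.
  apply Rmult_lt_0_compat; lra.
Qed.

Lemma unrolled_is_development : is_development unrolled.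
Proof.
  constructor.
  - intros t m m'. now rewrite distance2_unrolled, distance3_ruling.
  - apply continuous_unrolled.
  - intros m t Ht. apply regular_inside in Ht. destruct Ht as [k Hk].
    destruct (is_derive_unrolled k m t Hk). split; eexists; eassumption.
  - exact isometry_unrolled.
  - intros m t m' t' Hm Hm' Ht Ht'.
    pose proof (det_unrolled_neg m t Hm Ht).
    pose proof (det_unrolled_neg m' t' Hm' Ht'). nra.
  - intros m. rewrite unrolled_start, distance3_ruling.
    do 2 f_equal. rewrite Rabs_left by lra. ring.
  - exists (1 / 2). split; [lra | exact unrolled_xi_pos].
Qed.

(** * Rigidity of developments *)

(** Together with the point [F 0 t], this vector determines the whole developed
    line [t] ([development_affine]). *)
Definition ruling1 (F : R -> R -> vec2) (t : R) : R :=
  xi (F 1 t) - xi (F 0 t).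
Definition ruling2 (F : R -> R -> vec2) (t : R) : R :=
  eta (F 1 t) - eta (F 0 t).

Lemma distance2_sq (v w : vec2) :
  distance2 v w ^ 2 = (xi v - xi w) ^ 2 + (eta v - eta w) ^ 2.
Proof. apply pow2_sqrt, Rplus_le_le_0_compat; apply pow2_ge_0. Qed.

Lemma development_dist_sq (F : R -> R -> vec2) (m m' t : R) :
  is_development F ->
  (xi (F m t) - xi (F m' t)) ^ 2 + (eta (F m t) - eta (F m' t)) ^ 2
    = 3 * (m - m') ^ 2.
Proof.
  intros HF. rewrite <- distance2_sq, (dev_line F HF), distance3_ruling.
  rewrite Rpow_mult_distr, sqrt3_sq, pow2_abs. ring.
Qed.

Lemma development_ruling_norm (F : R -> R -> vec2) (t : R) :
  is_development F -> ruling1 F t ^ 2 + ruling2 F t ^ 2 = 3.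
Proof.
  intros HF. unfold ruling1, ruling2.
  rewrite development_dist_sq by assumption. ring.
Qed.

(** A map of the line that preserves distances up to the factor [sqrt 3] is
    affine. *)
Lemma development_affine (F : R -> R -> vec2) (m t : R) :
  is_development F ->
  xi (F m t) = xi (F 0 t) + m * ruling1 F t /\
  eta (F m t) = eta (F 0 t) + m * ruling2 F t.
Proof.
  intros HF.
  pose proof (development_dist_sq F m 0 t HF) as H0.
  pose proof (development_dist_sq F m 1 t HF) as H1.
  pose proof (development_dist_sq F 1 0 t HF) as H2.
  assert (E : (xi (F m t) - xi (F 0 t) - m * ruling1 F t) ^ 2
              + (eta (F m t) - eta (F 0 t) - m * ruling2 F t) ^ 2 = 0).
  (* Stewart's theorem: the squared distance from X to (1 - m) P + m Q is
     (1 - m) |XP|^2 + m |XQ|^2 - m (1 - m) |PQ|^2. *)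
  { transitivity ((1 - m) * (3 * (m - 0) ^ 2) + m * (3 * (m - 1) ^ 2)
                  - m * (1 - m) * (3 * (1 - 0) ^ 2)); [| ring].
    rewrite <- H0, <- H1, <- H2. unfold ruling1, ruling2. ring. }
  pose proof (pow2_ge_0 (xi (F m t) - xi (F 0 t) - m * ruling1 F t)).
  pose proof (pow2_ge_0 (eta (F m t) - eta (F 0 t) - m * ruling2 F t)).
  split; apply Rminus_diag_uniq; apply Rsqr_0_uniq; unfold Rsqr; lra.
Qed.

Lemma development_d_m2 (F : R -> R -> vec2) (m t : R) :
  is_development F -> d_m2 F m t = (ruling1 F t, ruling2 F t).
Proof.
  intros HF. unfold d_m2. f_equal; apply is_derive_unique;
    (eapply is_derive_ext;
      [intros u; symmetry; apply (development_affine F u t HF) |]);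
    auto_derive; trivial; ring.
Qed.

Lemma development_is_derive (F : R -> R -> vec2) (t : R) :
  is_development F -> regular_label t ->
  (is_derive (fun u => xi (F 0 u)) t (Derive (fun u => xi (F 0 u)) t) /\
   is_derive (fun u => eta (F 0 u)) t (Derive (fun u => eta (F 0 u)) t)) /\
  (is_derive (ruling1 F) t (Derive (ruling1 F) t) /\
   is_derive (ruling2 F) t (Derive (ruling2 F) t)).
Proof.
  intros HF Ht.
  destruct (dev_differentiable F HF 0 t Ht) as [A1 A2].
  destruct (dev_differentiable F HF 1 t Ht) as [C1 C2].
  split; split; apply Derive_correct; try assumption;
    apply (ex_derive_minus (V := R_NormedModule)); assumption.
Qed.

Lemma development_d_t2 (F : R -> R -> vec2) (m t : R) :
  is_development F -> regular_label t ->
  d_t2 F m t =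
    (Derive (fun u => xi (F 0 u)) t + m * Derive (ruling1 F) t,
     Derive (fun u => eta (F 0 u)) t + m * Derive (ruling2 F) t).
Proof.
  intros HF Ht.
  destruct (development_is_derive F t HF Ht) as [[A1 A2] [B1 B2]].
  unfold d_t2. f_equal; apply is_derive_unique;
    (eapply is_derive_ext;
      [intros u; symmetry; apply (development_affine F m u HF) |]).
  - apply (is_derive_plus (V := R_NormedModule)); [exact A1|].
    apply (is_derive_scal (ruling1 F)); exact B1.
  - apply (is_derive_plus (V := R_NormedModule)); [exact A2|].
    apply (is_derive_scal (ruling2 F)); exact B2.
Qed.

(** The ruling has constant length. *)
Lemma development_ruling_orth (F : R -> R -> vec2) (t : R) :
  is_development F -> regular_label t ->
  ruling1 F t * Derive (ruling1 F) t + ruling2 F t * Derive (ruling2 F) t = 0.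
Proof.
  intros HF Ht.
  destruct (development_is_derive F t HF Ht) as [_ [D1 D2]].
  assert (D : is_derive (fun u => ruling1 F u ^ 2 + ruling2 F u ^ 2) t
                (2 * (ruling1 F t * Derive (ruling1 F) t
                      + ruling2 F t * Derive (ruling2 F) t))).
  { evar_last.
    - apply (is_derive_plus (V := R_NormedModule));
        apply is_derive_pow; eassumption.
    - unfold plus; simpl. ring. }
  assert (D' : is_derive (fun u => ruling1 F u ^ 2 + ruling2 F u ^ 2) t 0).
  { apply is_derive_ext with (fun _ => 3).
    - intros u. symmetry. now apply development_ruling_norm.
    - apply (is_derive_const (V := R_NormedModule)). }
  apply is_derive_unique in D. apply is_derive_unique in D'. lra.
Qed.

Lemma is_derive_nonneg_right (f : R -> R) (x l delta : R) :
  is_derive f x l -> 0 < delta ->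
  (forall y, x < y < x + delta -> f x <= f y) -> 0 <= l.
Proof.
  intros D Hd Hf. apply Rnot_lt_le. intros Hl.
  apply is_derive_Reals in D.
  destruct (D (- l / 2) ltac:(lra)) as [e He].
  pose proof (cond_pos e) as He0.
  set (y := Rmin (e / 2) (delta / 2)).
  assert (Hy : 0 < y /\ y <= e / 2 /\ y <= delta / 2).
  { unfold y.
    repeat split; [apply Rmin_glb_lt; lra | apply Rmin_l | apply Rmin_r]. }
  specialize (He y ltac:(lra)). rewrite Rabs_right in He by lra.
  specialize (He ltac:(lra)). apply Rabs_lt_between in He.
  specialize (Hf (x + y) ltac:(lra)).
  assert (0 <= (f (x + y) - f x) / y) by (apply Rdiv_le_0_compat; lra).
  lra.
Qed.

Lemma regular_zero : regular_label 0.
Proof.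
  apply regular_inside. exists 0%Z. pose proof PI_RGT_0.
  unfold inside_cell, local_label. rewrite Rmult_0_l, Rminus_0_r, Rabs_R0. lra.
Qed.

(** The first fundamental form determines this determinant up to sign.  The
    sign is the same everywhere because the surface is not folded, and at the
    label 0 it is given by the orientation of the xi-axis: there the ruling is
    the eta-axis, and the developed points with small [m] move to [xi > 0]. *)
Lemma development_det_neg (F : R -> R -> vec2) (m t : R) :
  is_development F -> 0 < m < 1 -> regular_label t ->
  det2 (d_m2 F m t) (d_t2 F m t) < 0.
Proof.
  intros HF Hm Ht.
  destruct (dev_xi_orientation F HF) as [delta [Hd Hxi]].
  (* The orientation of the xi-axis speaks of small m, unfoldedness of
     0 < m < 1; m0 satisfies both. *)
  set (m0 := Rmin (delta / 2) (1 / 2)).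
  assert (Hm0 : 0 < m0 /\ m0 <= delta / 2 /\ m0 <= 1 / 2).
  { unfold m0.
    repeat split; [apply Rmin_glb_lt; lra | apply Rmin_l | apply Rmin_r]. }
  pose proof (dev_unfolded F HF m0 0 m0 0 ltac:(lra) ltac:(lra)
                regular_zero regular_zero) as U0.
  pose proof (dev_unfolded F HF m t m0 0 Hm ltac:(lra) Ht regular_zero) as U.
  assert (S : det2 (d_m2 F m0 0) (d_t2 F m0 0) <= 0).
  { destruct (dev_differentiable F HF m0 0 regular_zero) as [D _].
    apply Derive_correct in D.
    apply (is_derive_nonneg_right _ _ _ delta) in D; [| exact Hd |].
    - rewrite (development_d_m2 F m0 0 HF).
      unfold ruling1, ruling2. rewrite !(dev_start F HF), distance3_ruling.
      unfold det2, d_t2, xi, eta in *; cbn [fst snd] in *.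
      rewrite (Rabs_left (0 - 1)) by lra.
      change (0 <= Derive (fun u : R => fst (F m0 u)) 0) in D.
      pose proof (Rmult_le_pos _ _ (sqrt_pos 3) D). lra.
    - intros y Hy. rewrite (dev_start F HF).
      left. apply Hxi; [rewrite Rabs_right|]; lra. }
  nra.
Qed.

Lemma constant_on_cell (f : R -> R) :
  (forall t, continuous f t) ->
  (forall t, regular_label t -> is_derive f t 0) ->
  forall k t, in_cell k t -> f t = f (IZR k * cell_width).
Proof.
  intros C D k t Hk. pose proof PI_RGT_0.
  destruct (MVT_gen f (IZR k * cell_width) t (fun _ => 0)) as [x [_ E]].
  - intros x Hx. apply D. apply regular_inside. exists k.
    unfold in_cell, inside_cell, local_label in *.
    apply Rabs_le_between in Hk. apply Rabs_lt_between.
    unfold Rmin, Rmax in Hx. destruct (Rle_dec _ _); lra.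
  - intros x _. apply continuity_pt_filterlim, C.
  - lra.
Qed.

(** The labels that are not regular are isolated, so the mean value theorem on
    each closed cell suffices. *)
Lemma constant_of_derive_zero (f : R -> R) :
  (forall t, continuous f t) ->
  (forall t, regular_label t -> is_derive f t 0) ->
  forall t, f t = f 0.
Proof.
  intros C D. pose proof PI_RGT_0 as HPI.
  pose proof (constant_on_cell f C D) as K.
  assert (S : forall k, f (IZR (Z.succ k) * cell_width)
                        = f (IZR k * cell_width)).
  { intros k. rewrite <- (K k (IZR k * cell_width + 2 * PI / 3)).
    - symmetry. apply K. unfold in_cell, local_label, cell_width.
      rewrite succ_IZR. apply Rabs_le_between. lra.
    - unfold in_cell, local_label. apply Rabs_le_between. lra. }
  assert (Z0 : forall k, f (IZR k * cell_width) = f 0).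
  { apply Z.bi_induction.
    - intros x y ->. reflexivity.
    - now rewrite Rmult_0_l.
    - intros k. now rewrite S. }
  intros t. destruct (shift_in_cell t) as [k [_ Hk]].
  now rewrite (K k t Hk).
Qed.

(** The vector [(b1, b2)] and its quarter turn form an orthogonal basis. *)
Lemma frame_unique (b1 b2 x1 x2 y1 y2 : R) :
  b1 ^ 2 + b2 ^ 2 = 3 ->
  b1 * x1 + b2 * x2 = b1 * y1 + b2 * y2 ->
  b1 * x2 - b2 * x1 = b1 * y2 - b2 * y1 ->
  x1 = y1 /\ x2 = y2.
Proof.
  intros N Hd Hx. split.
  - assert (E : 3 * (x1 - y1) = b1 * (b1 * x1 + b2 * x2 - (b1 * y1 + b2 * y2))
       - b2 * (b1 * x2 - b2 * x1 - (b1 * y2 - b2 * y1)))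
      by (rewrite <- N; ring).
    rewrite Hd, Hx in E. lra.
  - assert (E : 3 * (x2 - y2) = b2 * (b1 * x1 + b2 * x2 - (b1 * y1 + b2 * y2))
       + b1 * (b1 * x2 - b2 * x1 - (b1 * y2 - b2 * y1)))
      by (rewrite <- N; ring).
    rewrite Hd, Hx in E. lra.
Qed.

(** Two vectors of the same length that turn with the same angular velocity keep
    their dot product: the left-hand side is its derivative. *)
Lemma frame_rotation (b1 b2 c1 c2 x1 x2 y1 y2 : R) :
  b1 ^ 2 + b2 ^ 2 = 3 -> c1 ^ 2 + c2 ^ 2 = 3 ->
  b1 * x1 + b2 * x2 = 0 -> c1 * y1 + c2 * y2 = 0 ->
  b1 * x2 - b2 * x1 = c1 * y2 - c2 * y1 ->
  x1 * c1 + b1 * y1 + (x2 * c2 + b2 * y2) = 0.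
Proof.
  intros N N' Hx Hy Hd. set (w := c1 * y2 - c2 * y1) in *.
  destruct (frame_unique b1 b2 x1 x2 (- w * b2 / 3) (w * b1 / 3) N)
    as [-> ->].
  { rewrite Hx. field. }
  { rewrite Hd. transitivity (w * (b1 ^ 2 + b2 ^ 2) / 3); [rewrite N|]; field. }
  destruct (frame_unique c1 c2 y1 y2 (- w * c2 / 3) (w * c1 / 3) N')
    as [E1 E2].
  { rewrite Hy. field. }
  { fold w. transitivity (w * (c1 ^ 2 + c2 ^ 2) / 3); [rewrite N'|]; field. }
  clearbody w. rewrite E1, E2. field.
Qed.

Lemma neg_sq_inj (x y : R) : x < 0 -> y < 0 -> x ^ 2 = y ^ 2 -> x = y.
Proof. intros Hx Hy E. nra. Qed.

(** Lagrange's identity: up to sign, the determinant is a function of the first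
    fundamental form. *)
Lemma lagrange2 (v w : vec2) :
  det2 v w ^ 2 = dot2 v v * dot2 w w - dot2 v w ^ 2.
Proof. unfold det2, dot2. ring. Qed.

Lemma developments_det (F G : R -> R -> vec2) (m t : R) :
  is_development F -> is_development G -> 0 < m < 1 -> regular_label t ->
  det2 (d_m2 F m t) (d_t2 F m t) = det2 (d_m2 G m t) (d_t2 G m t).
Proof.
  intros HF HG Hm Ht.
  apply neg_sq_inj; [now apply development_det_neg.. |].
  rewrite !lagrange2.
  destruct (dev_isometry F HF m t Ht) as [-> [-> ->]].
  destruct (dev_isometry G HG m t Ht) as [-> [-> ->]]. reflexivity.
Qed.

Lemma developments_first_order (F G : R -> R -> vec2) (t : R) :
  is_development F -> is_development G -> regular_label t ->
  ruling1 F t * Derive (fun u => xi (F 0 u)) t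
    + ruling2 F t * Derive (fun u => eta (F 0 u)) t
  = ruling1 G t * Derive (fun u => xi (G 0 u)) t
    + ruling2 G t * Derive (fun u => eta (G 0 u)) t /\
  ruling1 F t * Derive (fun u => eta (F 0 u)) t
    - ruling2 F t * Derive (fun u => xi (F 0 u)) t
  = ruling1 G t * Derive (fun u => eta (G 0 u)) t
    - ruling2 G t * Derive (fun u => xi (G 0 u)) t /\
  ruling1 F t * Derive (ruling2 F) t - ruling2 F t * Derive (ruling1 F) t
  = ruling1 G t * Derive (ruling2 G) t - ruling2 G t * Derive (ruling1 G) t.
Proof.
  intros HF HG Ht.
  (* Both determinants are affine in m, so two values of m suffice. *)
  pose proof (developments_det F G (1 / 3) t HF HG ltac:(lra) Ht) as P1.
  pose proof (developments_det F G (2 / 3) t HF HG ltac:(lra) Ht) as P2.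
  destruct (dev_isometry F HF 0 t Ht) as [_ [Q _]].
  destruct (dev_isometry G HG 0 t Ht) as [_ [QG _]].
  rewrite <- QG in Q.
  rewrite !(development_d_m2 F), !(development_d_m2 G), !(development_d_t2 F),
    !(development_d_t2 G) in * by assumption.
  unfold dot2, det2, xi, eta in *; cbn [fst snd] in *.
  repeat split; lra.
Qed.

(** Both rulings start as the same vector and turn with the same angular
    velocity, so their dot product stays equal to their squared length 3. *)
Lemma developments_rulings (F G : R -> R -> vec2) (t : R) :
  is_development F -> is_development G ->
  ruling1 F t = ruling1 G t /\ ruling2 F t = ruling2 G t.
Proof.
  intros HF HG.
  assert (C : forall H, is_development H -> forall u,
     continuous (ruling1 H) u /\ continuous (ruling2 H) u).
  { intros H HH u.
    destruct (dev_continuous H HH 0 u), (dev_continuous H HH 1 u).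
    split; apply (continuous_minus (V := R_NormedModule)); assumption. }
  assert (Hdot : ruling1 F t * ruling1 G t + ruling2 F t * ruling2 G t = 3).
  { rewrite (constant_of_derive_zero (fun u =>
      ruling1 F u * ruling1 G u + ruling2 F u * ruling2 G u)).
    - unfold ruling1, ruling2.
      rewrite !(dev_start F HF), !(dev_start G HG), distance3_ruling.
      unfold xi, eta; cbn [fst snd]. rewrite Rabs_left by lra.
      pose proof sqrt3_sq. lra.
    - intros u. destruct (C F HF u), (C G HG u).
      apply (continuous_plus (V := R_NormedModule));
        now apply (continuous_mult (K := R_AbsRing)).
    - intros u Hu.
      destruct (development_is_derive F u HF Hu) as [_ [F1 F2]].
      destruct (development_is_derive G u HG Hu) as [_ [G1 G2]].
      destruct (developments_first_order F G u HF HG Hu) as [_ [_ P]].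
      rewrite <- (frame_rotation _ _ _ _ _ _ _ _
        (development_ruling_norm F u HF) (development_ruling_norm G u HG)
        (development_ruling_orth F u HF Hu)
        (development_ruling_orth G u HG Hu) P).
      apply (is_derive_plus (V := R_NormedModule));
        (apply (is_derive_mult (K := R_AbsRing));
          [assumption | assumption | intros; apply Rmult_comm]). }
  pose proof (development_ruling_norm F t HF).
  pose proof (development_ruling_norm G t HG).
  assert ((ruling1 F t - ruling1 G t) ^ 2
          + (ruling2 F t - ruling2 G t) ^ 2 = 0) by lra.
  pose proof (pow2_ge_0 (ruling1 F t - ruling1 G t)).
  pose proof (pow2_ge_0 (ruling2 F t - ruling2 G t)).
  split; apply Rminus_diag_uniq; apply Rsqr_0_uniq; unfold Rsqr; lra.
Qed.

(** Once the rulings are known to agree, the velocity of the point [m = 0] has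
    the same components with respect to the ruling in both developments. *)
Lemma developments_starts (F G : R -> R -> vec2) (t : R) :
  is_development F -> is_development G ->
  xi (F 0 t) - xi (G 0 t) = 0 /\ eta (F 0 t) - eta (G 0 t) = 0.
Proof.
  intros HF HG.
  assert (D : forall u, regular_label u ->
    is_derive (fun u => xi (F 0 u) - xi (G 0 u)) u 0 /\
    is_derive (fun u => eta (F 0 u) - eta (G 0 u)) u 0).
  { intros u Hu.
    destruct (development_is_derive F u HF Hu) as [[F1 F2] _].
    destruct (development_is_derive G u HG Hu) as [[G1 G2] _].
    destruct (developments_first_order F G u HF HG Hu) as [Q [P _]].
    destruct (developments_rulings F G u HF HG) as [R1 R2].
    rewrite <- R1, <- R2 in Q, P.
    destruct (frame_unique _ _ _ _ _ _ (development_ruling_norm F u HF) Q P)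
      as [E1 E2].
    rewrite E1 in F1. rewrite E2 in F2.
    split; (evar_last;
      [apply (is_derive_minus (V := R_NormedModule)); eassumption
      | apply Rminus_diag_eq; reflexivity]). }
  split.
  - rewrite (constant_of_derive_zero (fun u => xi (F 0 u) - xi (G 0 u))).
    + rewrite (dev_start F HF), (dev_start G HG). ring.
    + intros u. apply (continuous_minus (V := R_NormedModule));
        [apply (dev_continuous F HF) | apply (dev_continuous G HG)].
    + intros u Hu. now apply D.
  - rewrite (constant_of_derive_zero (fun u => eta (F 0 u) - eta (G 0 u))).
    + rewrite (dev_start F HF), (dev_start G HG). ring.
    + intros u. apply (continuous_minus (V := R_NormedModule));
        [apply (dev_continuous F HF) | apply (dev_continuous G HG)].
    + intros u Hu. now apply D.
Qed.

Lemma developments_agree (F G : R -> R -> vec2) (m t : R) :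
  is_development F -> is_development G -> F m t = G m t.
Proof.
  intros HF HG.
  destruct (development_affine F m t HF) as [F1 F2].
  destruct (development_affine G m t HG) as [G1 G2].
  destruct (developments_rulings F G t HF HG) as [R1 R2].
  destruct (developments_starts F G t HF HG) as [S1 S2].
  unfold xi, eta in *.
  rewrite (surjective_pairing (F m t)), (surjective_pairing (G m t)).
  f_equal; [rewrite F1, G1, R1 | rewrite F2, G2, R2]; lra.
Qed.

(** * The developed touching curve *)

(** The parameters [base_parameter t] and [h t] agree up to sign. *)
Lemma touching_pole_h (lambda t : R) :
  touching_pole lambda t <-> 1 + lambda * cos (h t) = 0.
Proof.
  destruct (h_in_cell t) as [k [Hk [_ ->]]].
  unfold touching_pole. now rewrite (cos_base_parameter k t Hk).
Qed.

Lemma unrolled_touching_point (lambda t : R) :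
  1 + lambda * cos (h t) <> 0 ->
  unrolled (touching_m lambda (h t)) t
    = (kappa1_star lambda t, kappa2_star lambda t).
Proof.
  intros Hp. destruct (h_in_cell t) as [k [Hk [_ Eh]]].
  assert (Hv : Rabs (h t) <= 2 * PI / 3) by now rewrite Eh.
  unfold unrolled, kappa1_star, kappa2_star.
  now rewrite kappa1_tilde_on_ruling, kappa2_tilde_on_ruling by assumption.
Qed.

Lemma oloid_inj (m m' t : R) : oloid m t = oloid m' t -> m = m'.
Proof.
  intros E. pose proof (distance3_ruling m m' t) as D.
  pose proof (distance3_ruling m' m' t) as D'.
  rewrite E, D', Rminus_diag, Rabs_R0, Rmult_0_r in D.
  pose proof sqrt3_pos.
  apply Rminus_diag_uniq. destruct (Req_dec (m - m') 0) as [H0|H0]; trivial.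
  apply Rabs_pos_lt in H0. nra.
Qed.

Lemma touching_point_h (lambda t : R) :
  1 + lambda * cos (h t) <> 0 ->
  touching_point lambda t = oloid (touching_m lambda (h t)) t.
Proof.
  intros Hp. rewrite touching_point_on_ruling
    by now rewrite touching_pole_h.
  destruct (h_in_cell t) as [k [Hk [_ ->]]].
  unfold touching_m. now rewrite (cos_base_parameter k t Hk).
Qed.

Lemma developed_touching_point_star (F : R -> R -> vec2) (lambda t : R)
    (q : vec2) :
  is_development F -> 1 + lambda * cos (h t) <> 0 ->
  (developed_touching_point F lambda t q <->
   q = (kappa1_star lambda t, kappa2_star lambda t)).
Proof.
  intros HF Hp. unfold developed_touching_point.
  rewrite touching_point_h, <- unrolled_touching_point by assumption. split.
  - intros [m [E ->]]. apply oloid_inj in E. rewrite E.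
    apply developments_agree; [exact HF | exact unrolled_is_development].
  - intros ->. eexists. split; [reflexivity|].
    apply developments_agree; [exact unrolled_is_development | exact HF].
Qed.

Theorem theorem6 (lambda : R) :
  (exists F : R -> R -> vec2, is_development F) /\
  (forall F : R -> R -> vec2, is_development F ->
    (forall q : vec2,
       developed_touching_curve F lambda q <-> touching_curve_star lambda q) /\
    (forall (t : R) (q : vec2), 1 + lambda * cos (h t) <> 0 ->
       (developed_touching_point F lambda t q <->
        q = (kappa1_star lambda t, kappa2_star lambda t)))).
Proof.
  split; [exists unrolled; exact unrolled_is_development|].
  intros F HF. split.
  - intros q. split; intros [t [Hp Hq]]; exists t.
    + rewrite touching_pole_h in Hp. split; [exact Hp|].
      now apply (developed_touching_point_star F).
    + split; [now rewrite touching_pole_h|].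
      now apply (developed_touching_point_star F).
  - intros t q Hp. now apply developed_touching_point_star.
Qed.
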